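(* Let $\mu$ be a measure such that $L_1(\mu)$ is infinite dimensional and let $Y$ be a Banach space (both over the same scalar field $\mathbb{R}$ or $\mathbb{C}$). (1) If the pair $(L_1(\mu),Y)$ has the BPBZp, then $Y$ has the $Y^*$-AHSp. (2) If $Y$ has the $Y^*$-AHSp and the Radon-Nikodým property, then the pair $(L_1(\mu),Y)$ has the BPBZp.
   Context: $B_X$ and $S_X$ are the closed unit ball and unit sphere of a Banach space $X$, $X^*$ its topological dual, $\mathcal{L}(X,Y)$ the bounded linear operators from $X$ to $Y$. BPBZp (Bishop-Phelps-Bollobás-Zizler property): a pair $(X,Y)$ of Banach spaces has the BPBZp if for every $\varepsilon>0$ there exists $\eta(\varepsilon)>0$ such that whenever $T\in\mathcal{L}(X,Y)$ with $\|T\|=1$, $y_0^*\in S_{Y^*}$ and $x_0\in S_X$ satisfy $|y_0^*(Tx_0)|>1-\eta(\varepsilon)$, there exist $y_1^*\in S_{Y^*}$, $x_1\in S_X$ and $S\in\mathcal{L}(X,Y)$ with $\|S\|=|y_1^*(Sx_1)|=1$, $\|x_1-x_0\|<\varepsilon$, $\|y_1^*-y_0^*\|<\varepsilon$ and $\|S-T\|<\varepsilon$. $Y^*$-AHSp: $Y$ has the $Y^*$-AHSp if for every $\varepsilon>0$ there is $\eta(\varepsilon)>0$ such that whenever $\{y_k\}_{k\in\mathbb{N}}\subset B_Y$, $y^*\in S_{Y^*}$ and $a=(a_k)\in S_{\ell_1}$ with $a_k\ge 0$ for all $k$ satisfy $\operatorname{Re} y^*\left(\sum_{k=1}^\infty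 a_ky_k\right)>1-\eta(\varepsilon)$, there are $A\subset\mathbb{N}$, $\{z_k\}_{k\in A}\subset S_Y$ and $z^*\in S_{Y^*}$ such that (i) $\sum_{k\in A}a_k>1-\varepsilon$, (ii) $\|z_k-y_k\|<\varepsilon$ for all $k\in A$, (iii) $z^*(z_k)=1$ for all $k\in A$, (iv) $\|z^*-y^*\|<\varepsilon$. *)

(* Defs.v *)
From HB Require Import structures.
From mathcomp Require Import all_boot all_order all_algebra.
From mathcomp Require Import complex.
From mathcomp Require Import all_classical all_reals all_analysis.
From mathcomp Require Import measurable_realfun lebesgue_measure lebesgue_integral.

Set Implicit Arguments.
Unset Strict Implicit.
Unset Printing Implicit Defensive.
Import Order.TTheory GRing.Theory Num.Theory.
Import numFieldNormedType.Exports.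
Local Open Scope classical_set_scope.
Local Open Scope ring_scope.

Variant scalar_kind := RealScalars | ComplexScalars.

Definition scalars (R : realType) (k : scalar_kind) : numFieldType :=
  match k with RealScalars => R | ComplexScalars => R[i] end.

Definition sre (R : realType) (k : scalar_kind) : scalars R k -> R :=
  match k with
  | RealScalars => id
  | ComplexScalars => fun z : R[i] => complex.Re z
  end.

Definition sim (R : realType) (k : scalar_kind) : scalars R k -> R :=
  match k with
  | RealScalars => fun=> 0
  | ComplexScalars => fun z : R[i] => complex.Im z
  end.

Definition sofR (R : realType) (k : scalar_kind) : R -> scalars R k :=
  match k with
  | RealScalars => id
  | ComplexScalars => fun x : R => (x +i* 0)%C
  end.
Arguments sofR {R} k x.

Section scalar_lemmas.
Context (R : realType) (k : scalar_kind).
Local Notation K := (scalars R k).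
Implicit Types z w : K.

Lemma sreD z w : sre (z + w) = sre z + sre w.
Proof. by case: k z w => [//|] [a b] [a' b']. Qed.

Lemma simD z w : sim (z + w) = sim z + sim w.
Proof. by case: k z w => [z w|[a b] [a' b'] //]; rewrite /= addr0. Qed.

Lemma sre0 : sre (0 : K) = 0. Proof. by case: k. Qed.

Lemma sim0 : sim (0 : K) = 0. Proof. by case: k. Qed.

Lemma sreM z w : sre (z * w) = sre z * sre w - sim z * sim w.
Proof. by case: k z w => [z w|[a b] [a' b'] //]; rewrite /= mulr0 subr0. Qed.

Lemma simM z w : sim (z * w) = sre z * sim w + sim z * sre w.
Proof. by case: k z w => [z w|[a b] [a' b'] //]; rewrite /= mulr0 mul0r addr0. Qed.

Lemma sre_norm z : sre `|z| = Num.sqrt (sre z ^+ 2 + sim z ^+ 2).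
Proof.
case: k z => [z|z]; last by rewrite normc_def.
by rewrite /= expr0n /= addr0 sqrtr_sqr.
Qed.

Lemma sofR_norm z : sofR k (sre `|z|) = `|z|.
Proof. by case: k z => [z|z]//; rewrite normc_def. Qed.

Lemma sre_norm_ge0 z : 0 <= sre `|z|.
Proof. by rewrite sre_norm sqrtr_ge0. Qed.

Lemma sre_normM z w : sre (`|z| * `|w|) = sre `|z| * sre `|w|.
Proof. by case: k z w => [z|z w]//; rewrite !normc_def /= mulr0 subr0. Qed.

Lemma ler_sre z w : z <= w -> sre z <= sre w.
Proof.
by case: k z w => [//|z w]; rewrite lecE => /andP[].
Qed.

Lemma ler_sofR (x y : R) : x <= y -> sofR k x <= sofR k y.
Proof. by case: k => // xy; rewrite lecE /= eqxx. Qed.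

Lemma sofRD (x y : R) : sofR k (x + y) = sofR k x + sofR k y.
Proof. by case: k => //=; rewrite /GRing.add/= /ComplexField.addc /= addr0. Qed.

Lemma sofRM (x y : R) : sofR k (x * y) = sofR k x * sofR k y.
Proof.
by case: k => //=; apply/eqP; rewrite eq_complex /= !(mulr0, mul0r) subr0 addr0 !eqxx.
Qed.

Lemma sofR0 : sofR k (0 : R) = 0. Proof. by case: k. Qed.

Lemma sofR_inj (x y : R) : sofR k x = sofR k y -> x = y.
Proof. by case: k => [|[]]. Qed.

End scalar_lemmas.

(* The norm of a [normedModType] over [scalars R k] is a nonnegative element of
   [scalars R k]; [rnorm] is the same number seen in [R]. *)
Definition rnorm (R : realType) (k : scalar_kind)
  (V : normedModType (scalars R k)) (v : V) : R := sre `|v|.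

Section L1_functions.
Context (R : realType) (k : scalar_kind) d (T : measurableType d)
  (mu : {measure set T -> \bar R}).
Local Notation K := (scalars R k).

Definition integrable_fun : set (T -> K^o) :=
  [set f | [/\ measurable_fun setT (fun x => sre (f x : K)),
               measurable_fun setT (fun x => sim (f x : K)) &
               (\int[mu]_x (sre (`|f x| : K))%:E < +oo)%E ]].

Definition integrable_pred : {pred T -> K^o} := mem integrable_fun.

Lemma measurable_sre_norm (f : T -> K) :
  measurable_fun setT (fun x => sre (f x)) ->
  measurable_fun setT (fun x => sim (f x)) ->
  measurable_fun setT (fun x => sre `|f x|).
Proof.
move=> mr mi; under eq_fun do rewrite sre_norm.
apply: (@measurableT_comp _ _ _ _ _ _ (@Num.sqrt R)).
  exact: continuous_measurable_fun (@sqrt_continuous R).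
by apply: measurable_funD; apply: measurable_funX.
Qed.

Lemma integrable_submod_closed : submod_closed integrable_pred.
Proof.
split.
  rewrite inE; split => /=.
  - by under eq_fun do rewrite sre0; exact: measurable_cst.
  - by under eq_fun do rewrite sim0; exact: measurable_cst.
  - under eq_integral do rewrite normr0 sre0.
    by rewrite integral0 ltry.
move=> a f g; rewrite !inE => -[mrf mif fi] [mrg mig gi].
have mafr : measurable_fun setT (fun x => sre ((a *: f + g) x : K)).
  rewrite [X in measurable_fun _ X](_ : _ = fun x =>
    sre a * sre (f x : K) - sim a * sim (f x : K) + sre (g x : K)); last first.
    by apply/funext => x; rewrite -sreM -sreD.
  apply: measurable_funD => //; apply: measurable_funB; exact: measurable_funM.
have mafi : measurable_fun setT (fun x => sim ((a *: f + g) x : K)).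
  rewrite [X in measurable_fun _ X](_ : _ = fun x =>
    sre a * sim (f x : K) + sim a * sre (f x : K) + sim (g x : K)); last first.
    by apply/funext => x; rewrite -simM -simD.
  apply: measurable_funD => //; apply: measurable_funD; exact: measurable_funM.
split => //.
apply: (@le_lt_trans _ _ (\int[mu]_x ((sre `|a|)%:E * (sre (`|f x| : K))%:E
     + (sre (`|g x| : K))%:E))%E).
  apply: ge0_le_integral => //.
  - by move=> x _; rewrite lee_fin sre_norm_ge0.
  - by apply/measurable_EFinP; exact: measurable_sre_norm.
  - apply: emeasurable_funD; last by apply/measurable_EFinP; exact: measurable_sre_norm.
    by apply/measurable_EFinP; apply: measurable_funM => //; exact: measurable_sre_norm.
  - move=> x _; rewrite -EFinM -EFinD lee_fin -sre_normM -sreD.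
    by rewrite ler_sre// -normrM ler_normD.
rewrite ge0_integralD//.
- rewrite ge0_integralZl//.
  + by rewrite lte_add_pinfty// lte_mul_pinfty// ?lee_fin ?sre_norm_ge0.
  + by apply/measurable_EFinP; exact: measurable_sre_norm.
  + by move=> x _; rewrite lee_fin sre_norm_ge0.
  + by rewrite lee_fin sre_norm_ge0.
- by move=> x _; rewrite -EFinM lee_fin mulr_ge0 ?sre_norm_ge0.
- by apply/measurable_EFinP; apply: measurable_funM => //; exact: measurable_sre_norm.
- by move=> x _; rewrite lee_fin sre_norm_ge0.
- by apply/measurable_EFinP; exact: measurable_sre_norm.
Qed.

HB.instance Definition _ := GRing.isSubmodClosed.Build K (T -> K^o)
  integrable_pred integrable_submod_closed.

Record L1fun := MkL1fun {
  L1fun_val :> T -> K^o ;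
  L1funP : L1fun_val \in integrable_pred }.

HB.instance Definition _ := [isSub for L1fun_val].
HB.instance Definition _ := [Choice of L1fun by <:].
HB.instance Definition _ := [SubChoice_isSubLmodule of L1fun by <:].

Definition null_pred : {pred L1fun} :=
  mem [set f : L1fun | {ae mu, forall x, f x = 0}].

Lemma null_submod_closed : submod_closed null_pred.
Proof.
split; first by rewrite inE; apply: aeW => x.
move=> a f g; rewrite !inE => f0 g0.
apply: filterS2 f0 g0 => x /= fx gx.
by change (a *: f x + g x = 0); rewrite fx gx scaler0 addr0.
Qed.

HB.instance Definition _ := GRing.isSubmodClosed.Build K L1fun
  null_pred null_submod_closed.

Definition L1 : Type := Quotient.quot null_pred.
HB.instance Definition _ := GRing.Zmodule.on L1.

Definition L1class (f : L1fun) : L1 := (\pi_(Quotient.quot null_pred) f)%qT.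
Definition L1repr (u : L1) : L1fun := repr u.

Lemma L1reprK u : L1class (L1repr u) = u.
Proof. exact: reprK. Qed.

Lemma L1classP (f g : L1fun) :
  L1class f = L1class g <-> {ae mu, forall x, f x = g x}.
Proof.
split=> [/eqP|fg]; last apply/eqP.
  rewrite -Quotient.idealrBE inE /=.
  apply: filterS => x fgx; apply/eqP; rewrite -subr_eq0; apply/eqP.
  exact: fgx.
rewrite /L1class -Quotient.idealrBE inE /=.
apply: filterS fg => x fgx.
by change (f x - g x = 0); rewrite fgx subrr.
Qed.

Lemma L1class_add (f g : L1fun) : L1class (f + g) = L1class f + L1class g.
Proof. exact: (Quotient.pi_add null_pred f g). Qed.

Definition L1scale (a : K) (u : L1) : L1 := L1class (a *: L1repr u).

Lemma L1class_scale a (f : L1fun) : L1class (a *: f) = L1scale a (L1class f).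
Proof.
apply/L1classP.
have /L1classP : L1class f = L1class (L1repr (L1class f)) by rewrite L1reprK.
apply: filterS => x fx.
by change (a *: f x = a *: L1repr (L1class f) x); rewrite fx.
Qed.

Lemma L1scaleA a b u : L1scale a (L1scale b u) = L1scale (a * b) u.
Proof.
by rewrite -[u]L1reprK -!L1class_scale scalerA.
Qed.

Lemma L1scale1 : left_id 1 L1scale.
Proof. by move=> u; rewrite /L1scale scale1r L1reprK. Qed.

Lemma L1scaleDr : right_distributive L1scale +%R.
Proof.
move=> a u v; rewrite -[u]L1reprK -[v]L1reprK.
by rewrite -L1class_add -!L1class_scale -L1class_add scalerDr.
Qed.

Lemma L1scaleDl u : {morph L1scale^~ u : a b / a + b}.
Proof.
by move=> a b; rewrite -[u]L1reprK -!L1class_scale -L1class_add scalerDl.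
Qed.

HB.instance Definition _ := GRing.Zmodule_isLmodule.Build K L1
  L1scaleA L1scale1 L1scaleDr L1scaleDl.

Definition L1norm (u : L1) : K :=
  sofR k (\int[mu]_x sre (`|L1repr u x| : K)).

Lemma L1fun_integrable_norm (f : L1fun) :
  mu.-integrable setT (EFin \o (fun x => sre (`|f x| : K))).
Proof.
have := L1funP f; rewrite inE => -[mr mi fi].
apply/integrableP; split.
  by apply/measurable_EFinP; exact: measurable_sre_norm.
by under eq_integral do rewrite /= ger0_norm ?sre_norm_ge0//.
Qed.

Lemma L1norm_class (f : L1fun) :
  L1norm (L1class f) = sofR k (\int[mu]_x sre (`|f x| : K)).
Proof.
congr (sofR k (fine _)).
have := L1fun_integrable_norm (L1repr (L1class f)) => /measurable_int m1.
have := L1fun_integrable_norm f => /measurable_int m2.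
apply: ae_eq_integral => //.
have /L1classP : L1class (L1repr (L1class f)) = L1class f by rewrite L1reprK.
by apply: filterS => x fx _ /=; rewrite fx.
Qed.

Lemma L1normD u v : L1norm (u + v) <= L1norm u + L1norm v.
Proof.
rewrite -[u]L1reprK -[v]L1reprK -L1class_add !L1norm_class -sofRD.
apply: ler_sofR.
rewrite -RintegralD//; [|exact: L1fun_integrable_norm..].
apply: le_Rintegral => //.
- exact: L1fun_integrable_norm.
- exact: (integrableD measurableT
    (L1fun_integrable_norm (L1repr u)) (L1fun_integrable_norm (L1repr v))).
- by move=> x _; rewrite -sreD; apply: ler_sre; exact: ler_normD.
Qed.

Lemma L1normZ (a : K) u : L1norm (a *: u) = `|a| * L1norm u.
Proof.
rewrite -[u]L1reprK -[a *: _]L1class_scale !L1norm_class -[`|a|]sofR_norm -sofRM.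
congr (sofR k _); rewrite -RintegralZl//; last exact: L1fun_integrable_norm.
apply: eq_Rintegral => x _.
by rewrite -sre_normM -normrM.
Qed.

Lemma L1norm_eq0 u : L1norm u = 0 -> u = 0.
Proof.
rewrite -[u]L1reprK L1norm_class -(@sofR0 R k) => /sofR_inj u0.
apply: (@etrans _ _ (L1class 0)); last first.
  by rewrite /L1class (raddf0 (\pi_(Quotient.quot null_pred))%qT).
apply/L1classP.
have iu := L1fun_integrable_norm (L1repr u).
have : (\int[mu]_x `|(sre (`|L1repr u x| : K))%:E| = 0)%E.
  rewrite -(@fineK _ (\int[mu]_x _)%E).
    rewrite -[RHS]/(0%:E) -u0; congr (fine _)%:E.
    by apply: eq_integral => x _ /=; rewrite ger0_norm ?sre_norm_ge0.
  by apply: integrable_fin_num => //; exact: integrable_abse.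
move/(ae_eq_integral_abs mu measurableT (measurable_int _ iu)).
apply: filterS => x /(_ I)[] /= nx0.
apply/eqP; rewrite -normr_eq0 -sofR_norm nx0.
by rewrite sofR0.
Qed.

HB.instance Definition _ :=
  Lmodule_isNormed.Build K L1 L1normD L1normZ L1norm_eq0.

End L1_functions.

Arguments L1 {R} k {d T} mu.

Section bounded_operators.
Context (R : realType) (k : scalar_kind).
Local Notation K := (scalars R k).

Definition unit_ball (V : normedModType K) : set V := [set v | rnorm v <= 1].
Arguments unit_ball : clear implicits.

Definition unit_sphere (V : normedModType K) : set V := [set v | rnorm v = 1].
Arguments unit_sphere : clear implicits.

(* Only meaningful for operators bounded on the unit ball: [sup] is 0 on
   unbounded sets. *)
Definition opnorm (V W : normedModType K) (f : V -> W) : R :=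
  sup [set rnorm (f v) | v in unit_ball V].

Definition bounded_operators (V W : normedModType K) : set {linear V -> W} :=
  [set f | continuous f].
Arguments bounded_operators : clear implicits.

Definition dual_sphere (V : normedModType K) : set {linear V -> K^o} :=
  [set f | bounded_operators V K^o f /\ opnorm f = 1].
Arguments dual_sphere : clear implicits.

Definition infinite_dimensional (V : lmodType K) : Prop :=
  ~ exists (n : nat) (e : 'I_n -> V),
      forall v : V, exists c : 'I_n -> K, v = \sum_(i < n) c i *: e i.

End bounded_operators.

Arguments unit_ball {R k} V _.
Arguments unit_sphere {R k} V _.
Arguments bounded_operators {R k} V W _.
Arguments dual_sphere {R k} V _.

Definition BPBZp (R : realType) (k : scalar_kind)
    (X Y : normedModType (scalars R k)) : Prop :=
  forall eps : R, 0 < eps -> exists eta : R, 0 < eta /\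
    forall (T : {linear X -> Y}) (ystar0 : {linear Y -> (scalars R k)^o}) (x0 : X),
      bounded_operators X Y T -> opnorm T = 1 ->
      dual_sphere Y ystar0 -> unit_sphere X x0 ->
      rnorm (ystar0 (T x0)) > 1 - eta ->
      exists (ystar1 : {linear Y -> (scalars R k)^o}) (x1 : X) (S : {linear X -> Y}),
        [/\ dual_sphere Y ystar1, unit_sphere X x1 & bounded_operators X Y S] /\
        [/\ opnorm S = 1, rnorm (ystar1 (S x1)) = 1, rnorm (x1 - x0) < eps,
            opnorm (fun y => ystar1 y - ystar0 y) < eps &
            opnorm (fun x => S x - T x) < eps].

Definition YstarAHSp (R : realType) (k : scalar_kind)
    (Y : completeNormedModType (scalars R k)) : Prop :=
  forall eps : R, 0 < eps -> exists eta : R, 0 < eta /\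
    forall (y : nat -> Y) (ystar : {linear Y -> (scalars R k)^o}) (a : nat -> R),
      (forall j, unit_ball Y (y j)) -> dual_sphere Y ystar ->
      (forall j, 0 <= a j) ->
      (\sum_(0 <= j <oo) `|a j|%:E)%E = 1%E ->
      sre (ystar (limn (series (fun j => sofR k (a j) *: y j)))) > 1 - eta ->
      exists (A : set nat) (z : nat -> Y) (zstar : {linear Y -> (scalars R k)^o}),
        [/\ forall j, A j -> unit_sphere Y (z j) & dual_sphere Y zstar] /\
        [/\ (\esum_(j in A) (a j)%:E > (1 - eps)%:E)%E,
            forall j, A j -> rnorm (z j - y j) < eps,
            forall j, A j -> zstar (z j) = 1 &
            opnorm (fun v => zstar v - ystar v) < eps].

Section bochner_integral.
Context (R : realType) (k : scalar_kind) d (T : measurableType d)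
  (lam : {finite_measure set T -> \bar R})
  (Y : completeNormedModType (scalars R k)).
Implicit Types (f : T -> Y) (s : nat -> T -> Y).

Definition simple_fun f : Prop :=
  finite_set (range f) /\ forall y, measurable (f @^-1` [set y]).

Definition simple_integral (E : set T) f : Y :=
  \sum_(y \in range f) sofR k (fine (lam (E `&` f @^-1` [set y]))) *: y.

Definition strongly_measurable f : Prop :=
  exists s, (forall n, simple_fun (s n)) /\
    {ae lam, forall x, s n x @[n --> \oo] --> f x}.

Definition bochner_approx f s : Prop :=
  (forall n, simple_fun (s n)) /\
  (\int[lam]_x (rnorm (s n x - f x))%:E)%E @[n --> \oo] --> 0%E.

Definition bochner_integrable f : Prop :=
  strongly_measurable f /\ exists s, bochner_approx f s.

(* [I] is the limit of the integrals over [E] of approximating simple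
   functions; this limit does not depend on the approximation. *)
Definition is_bochner_integral (E : set T) f (I : Y) : Prop :=
  bochner_integrable f /\
  exists s, bochner_approx f s /\ simple_integral E (s n) @[n --> \oo] --> I.

(* values of [G] outside the sigma-algebra are irrelevant *)
Definition vector_measure (G : set T -> Y) : Prop :=
  forall F : (set T)^nat, (forall n, measurable (F n)) -> trivIset setT F ->
    series (fun n => G (F n)) @ \oo --> G (\bigcup_n F n).

Definition variation (G : set T -> Y) (E : set T) : \bar R :=
  ereal_sup [set v | exists (n : nat) (F : 'I_n -> set T),
    [/\ forall i, measurable (F i), trivIset setT F, \bigcup_i F i = E &
        v = (\sum_(i < n) (rnorm (G (F i)))%:E)%E]].

Definition bounded_variation_measure (G : set T -> Y) : Prop :=
  (variation G setT < +oo)%E.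

Definition abs_continuous (G : set T -> Y) : Prop :=
  forall eps : R, 0 < eps -> exists delta : R, 0 < delta /\
    forall E, measurable E -> (lam E < delta%:E)%E -> rnorm (G E) < eps.

End bochner_integral.

Definition Radon_Nikodym_property (R : realType) (k : scalar_kind)
    (Y : completeNormedModType (scalars R k)) : Prop :=
  forall d (T : measurableType d) (lam : {finite_measure set T -> \bar R})
    (G : set T -> Y),
    vector_measure G -> bounded_variation_measure G -> abs_continuous lam G ->
    exists g : T -> Y, bochner_integrable lam g /\
      forall E, measurable E -> is_bochner_integral lam E g (G E).

(* Main.v *)
Require Import Defs.
From HB Require Import structures.
From mathcomp Require Import all_boot all_order all_algebra.
From mathcomp Require Import complex.
From mathcomp Require Import all_classical all_reals all_analysis.
From mathcomp Require Import measurable_realfun.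
From mathcomp Require Import ring lra.

(** (1) In an infinite dimensional L_1(mu) there are arbitrarily many disjoint sets F_j of
finite positive measure. Cut the series sum a_j y_j at some N, and apply the BPBZp to
the finite rank operator h |-> sum_(j < N) (int_(F_j) h) y_j, normalized, and to the
function sum_(j < N) b_j 1_(F_j) / mu(F_j), where b is a normalized on [0, N). If S, x1
and z* (the rotated functional) are what it provides, z* o S attains its norm at x1,
hence at each restriction r_j of x1 to F_j, so S(r_j) / |r_j| is a norming vector for z*;
it is close to y_j for most j, because x1 is close to the given function.

(2) Given an operator V and a norm one f in L_1(mu), the vector measure E |-> V(f 1_E) is
dominated by |f| mu. The Radon-Nikodym property cuts the space into countably many sets
C_j on which this vector measure is nearly a scalar measure times a vector y_j; for y_j
one can take the average over C_j, and then sum_j (int_(C_j) |f|) y_j = V f. The AHSp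
moves finitely many of the y_j to vectors z_j with a common norming functional, and V
is replaced by h |-> (int_(C_j) h |f| / f) z_j on each of these C_j. *)

Set Implicit Arguments.
Unset Strict Implicit.
Unset Printing Implicit Defensive.
Import Order.TTheory GRing.Theory Num.Theory.
Import numFieldNormedType.Exports.
Local Open Scope classical_set_scope.
Local Open Scope ring_scope.

(** * Scalars and norms *)

Section scalars.
Context (R : realType) (k : scalar_kind).
Local Notation K := (scalars R k).
Implicit Types (z w : K) (x y : R).

(** Since [mu] is arbitrary, neither the duality with [L_infty] nor a density representing a whole
    operator on [L_1(mu)] is at hand. In (2) everything is therefore relative to the given [f]: the
    measure [|f| mu] is finite whatever [mu] is. The price is that the Radon-Nikodym property
    controls [V] only on restrictions of [f], while the new operator has to be close to [V] at every
    [h]. On the support of [f] the combinations of such restrictions are dense, which closes the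
    gap; off the support nothing is known about [V], and the new operator has to coincide with it
    there. What makes piecewise estimates usable is that the norm of [L_1] is additive over disjoint
    sets, so a bound on each piece becomes a global bound with the same constant. The BPBZp speaks
    of a modulus, the AHSp of a real part and of the exact value 1. In (2) the functional is rotated
    beforehand and rotated back at the end, at no cost. In (1) it is rotated afterwards, and the
    rotation must be shown close to the identity, which is why [eta] involves a square. *)

Definition smk x y : K :=
  match k return scalars R k with
  | RealScalars => x
  | ComplexScalars => (x +i* y)%C
  end.

Lemma sre_smk x y : sre (smk x y) = x.
Proof. by rewrite /smk; case: k. Qed.

(** Over the reals [smk] drops its second argument, so only a number that is already an imaginary
    part can be recovered. *)
Lemma sim_smk_sim x z : sim (smk x (sim z)) = sim z.
Proof. by rewrite /smk; case: k z. Qed.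

Lemma scalar_ext z w : sre z = sre w -> sim z = sim w -> z = w.
Proof. by case: k z w => [//|[a b] [a' b']] /= -> ->. Qed.

Lemma sre_sofR x : sre (sofR k x) = x.
Proof. by case: k. Qed.

Lemma sim_sofR x : sim (sofR k x) = 0.
Proof. by case: k. Qed.

Lemma sofR1 : sofR k (1 : R) = 1.
Proof. by case: k. Qed.

Lemma sofRN x : sofR k (- x) = - sofR k x.
Proof. by apply: (addrI (sofR k x)); rewrite -sofRD !subrr sofR0. Qed.

Lemma sofRB x y : sofR k (x - y) = sofR k x - sofR k y.
Proof. by rewrite sofRD sofRN. Qed.

Lemma sreN z : sre (- z) = - sre z.
Proof. by apply: (addrI (sre z)); rewrite -sreD !subrr sre0. Qed.

Lemma simN z : sim (- z) = - sim z.
Proof. by apply: (addrI (sim z)); rewrite -simD !subrr sim0. Qed.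

Lemma sreB z w : sre (z - w) = sre z - sre w.
Proof. by rewrite sreD sreN. Qed.

Lemma simB z w : sim (z - w) = sim z - sim w.
Proof. by rewrite simD simN. Qed.

Lemma sre_le_norm z : `|sre z| <= sre `|z|.
Proof.
rewrite sre_norm -sqrtr_sqr ler_sqrt ?addr_ge0 ?sqr_ge0//.
by rewrite lerDl sqr_ge0.
Qed.

Lemma sim_le_norm z : `|sim z| <= sre `|z|.
Proof.
rewrite sre_norm -sqrtr_sqr ler_sqrt ?addr_ge0 ?sqr_ge0//.
by rewrite lerDr sqr_ge0.
Qed.

Lemma norm_sofR x : `|sofR k x| = sofR k `|x|.
Proof.
by rewrite -sofR_norm sre_norm sre_sofR sim_sofR expr0n addr0 sqrtr_sqr.
Qed.

Lemma sofR_le x y : (sofR k x <= sofR k y) = (x <= y).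
Proof.
by apply/idP/idP => [/ler_sre|/ler_sofR]; rewrite ?sre_sofR//; apply.
Qed.

Lemma sofR_lt x y : (sofR k x < sofR k y) = (x < y).
Proof.
by rewrite !lt_neqAle sofR_le; congr andb; congr negb; apply/eqP/eqP => [/sofR_inj|->].
Qed.

(* Equality in [sre z <= |z|]. *)
Lemma sre_norm_eq z x : sre z = x -> sre `|z| <= x -> z = sofR k x.
Proof.
move=> zx; rewrite sre_norm zx => h; apply: scalar_ext; rewrite ?sre_sofR ?sim_sofR//.
have x0 : 0 <= x by apply: le_trans h; exact: sqrtr_ge0.
move: h; rewrite -(ler_pXn2r (n := 2))// ?nnegrE ?sqrtr_ge0//.
rewrite sqr_sqrtr ?addr_ge0 ?sqr_ge0// gerDl => h.
by apply/eqP; rewrite -sqrf_eq0 eq_le h sqr_ge0.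
Qed.

(** Expanding, [|1 - z|^2 = 1 - 2 Re z + |z|^2]. A real part within [e^2 / 2] of 1 thus puts [z]
    within [e] of 1. *)
Lemma norm_1sub_sqr z : sre `|z| <= 1 -> sre `|1 - z| ^+ 2 <= 2 - 2 * sre z.
Proof.
rewrite !sre_norm => h.
rewrite sqr_sqrtr ?addr_ge0 ?sqr_ge0//.
rewrite sreB simB -sofR1 sre_sofR sim_sofR.
have : sre z ^+ 2 + sim z ^+ 2 <= 1.
  by rewrite -[X in X <= _]sqr_sqrtr ?addr_ge0 ?sqr_ge0// expr_le1// sqrtr_ge0.
by move: (sre z) (sim z) => a b; nra.
Qed.

Lemma sreV z : sre z^-1 = sre z / (sre z ^+ 2 + sim z ^+ 2).
Proof.
case: k z => [z|[a b]] /=.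
  rewrite expr0n addr0; have [->|z0] := eqVneq z 0; first by rewrite invr0 mul0r.
  by rewrite expr2 invfM mulrA mulfV// mul1r.
by [].
Qed.

Lemma simV z : sim z^-1 = - sim z / (sre z ^+ 2 + sim z ^+ 2).
Proof. by case: k z => [z|[a b]] /=; rewrite ?oppr0 ?mul0r// mulNr. Qed.

End scalars.

Section rnorm.
Context (R : realType) (k : scalar_kind).
Local Notation K := (scalars R k).
Context (V : normedModType K).
Implicit Types (u v : V) (a : K).

Lemma norm_rnorm v : `|v| = sofR k (rnorm v).
Proof. by have := sofR_norm (`|v| : K); rewrite normr_id. Qed.

Lemma rnorm_ge0 v : 0 <= rnorm v.
Proof. by rewrite -(sofR_le k) -norm_rnorm sofR0. Qed.

Lemma rnorm0 : rnorm (0 : V) = 0.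
Proof. by rewrite /rnorm normr0 sre0. Qed.

Lemma rnorm_eq0 v : rnorm v = 0 -> v = 0.
Proof. by move=> h; apply/eqP; rewrite -normr_eq0 norm_rnorm h sofR0. Qed.

Lemma rnormD u v : rnorm (u + v) <= rnorm u + rnorm v.
Proof. by rewrite -(sofR_le k) sofRD -!norm_rnorm ler_normD. Qed.

Lemma rnormN v : rnorm (- v) = rnorm v.
Proof. by rewrite /rnorm normrN. Qed.

Lemma rdistC u v : rnorm (u - v) = rnorm (v - u).
Proof. by rewrite /rnorm distrC. Qed.

Lemma rnormZ a v : rnorm (a *: v) = sre `|a| * rnorm v.
Proof.
by apply: (@sofR_inj R k); rewrite sofRM -!norm_rnorm sofR_norm normrZ.
Qed.

Lemma rnormZR (x : R) v : rnorm (sofR k x *: v) = `|x| * rnorm v.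
Proof. by rewrite rnormZ norm_sofR sre_sofR. Qed.

Lemma rnorm_sum (I : Type) (r : seq I) (P : pred I) (F : I -> V) :
  rnorm (\sum_(i <- r | P i) F i) <= \sum_(i <- r | P i) rnorm (F i).
Proof.
elim/big_ind2 : _ => [|x1 x2 y1 y2 h1 h2|//]; first by rewrite rnorm0.
by rewrite (le_trans (rnormD _ _))// lerD.
Qed.

Lemma rnorm_trans w u v : rnorm (u - v) <= rnorm (u - w) + rnorm (w - v).
Proof. by rewrite -[u - v](subrKA w) rnormD. Qed.

Lemma rnorm_dist u v : `|rnorm u - rnorm v| <= rnorm (u - v).
Proof.
have h u' v' : rnorm u' - rnorm v' <= rnorm (u' - v').
  by rewrite lerBlDr -{1}(subrK v' u') rnormD.
by rewrite ler_norml h andbT lerNl opprB rdistC h.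
Qed.

Lemma rnorm_lt (v : V) (x : R) : (rnorm v < x) = (`|v| < sofR k x).
Proof. by rewrite norm_rnorm sofR_lt. Qed.

Lemma gt0_sofR (e : K) : 0 < e -> exists x : R, 0 < x /\ e = sofR k x.
Proof.
move=> e0; exists (sre `|e|); rewrite -(sofR_lt k) sofR_norm sofR0.
by rewrite normr_gt0 gt_eqF//= gtr0_norm.
Qed.

Lemma rnorm_cvgP (u : nat -> V) v :
  (u n @[n --> \oo] --> v) <-> (rnorm (u n - v) @[n --> \oo] --> (0 : R)).
Proof.
split=> h.
- apply/cvgrPdist_lt => e e0.
  have e0' : 0 < sofR k e by rewrite -(sofR0 R k) sofR_lt.
  move/cvgrPdist_lt : h => /(_ _ e0') [N _ h].
  exists N => // n /h /=; rewrite -rnorm_lt sub0r normrN ger0_norm ?rnorm_ge0//.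
  by rewrite rdistC.
- apply/cvgrPdist_lt => e /gt0_sofR[x [x0 ->]].
  move/cvgrPdist_lt : h => /(_ _ x0) [N _ h].
  exists N => // n /h /=; rewrite sub0r normrN ger0_norm ?rnorm_ge0// => ux.
  by rewrite -rnorm_lt rdistC.
Qed.

End rnorm.

(** * Operator norms *)

Section opnorm.
Context (R : realType) (k : scalar_kind).
Local Notation K := (scalars R k).
Implicit Types (V W : normedModType K).

Lemma bounded_continuous V W (f : {linear V -> W}) (M : R) :
  (forall v, rnorm (f v) <= M * rnorm v) -> bounded_operators V W f.
Proof.
move=> fM; apply: bounded_linear_continuous; apply/linear_boundedP.
have M1 : `|M| + 1 > 0 by rewrite ltr_wpDl.
exists (sofR k (`|M| + 1)); split.
  by rewrite realE -(sofR0 R k) sofR_le ltW.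
move=> r Mr v; rewrite (le_trans (y := sofR k (`|M| + 1) * `|v|))//.
  rewrite !norm_rnorm -sofRM sofR_le (le_trans (fM v))// ler_wpM2r ?rnorm_ge0//.
  by rewrite (le_trans (ler_norm _))// lerDl.
by rewrite ler_wpM2r// ltW.
Qed.

Lemma continuous_bounded V W (f : {linear V -> W}) : bounded_operators V W f ->
  exists M : R, forall v, rnorm (f v) <= M * rnorm v.
Proof.
move=> fc; have /linear_boundedP/pinfty_ex_gt0 : bounded_near f (nbhs 0).
  by apply/linear_bounded_continuous.
move=> [r /gt0_sofR[x [x0 ->]] fr]; exists x => v.
by rewrite -(sofR_le k) sofRM -!norm_rnorm.
Qed.

Lemma opnorm_le V W (f : V -> W) (c : R) : 0 <= c ->
  (forall v, rnorm (f v) <= c * rnorm v) -> opnorm f <= c.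
Proof.
move=> c0 fc; apply: ge_sup.
  by exists (rnorm (f 0)); exists 0 => //; rewrite /unit_ball /= rnorm0 ler01.
by move=> _ [v v1 <-]; rewrite (le_trans (fc v))// ler_piMr.
Qed.

(** The bound [M] makes the supremum a genuine one. Only homogeneity is asked of [f], so that the
    result applies to pointwise differences of operators that are not packaged as linear maps. *)
Lemma opnorm_bound V W (f : V -> W) (M : R) :
  (forall a v, f (a *: v) = a *: f v) ->
  (forall v, rnorm (f v) <= M * rnorm v) ->
  forall v, rnorm (f v) <= opnorm f * rnorm v.
Proof.
move=> fZ fM v; have [v0|v0] := eqVneq (rnorm v) 0.
  by rewrite v0 mulr0 -[leRHS](mulr0 M) -v0.
have vp : 0 < rnorm v by rewrite lt_neqAle eq_sym v0 rnorm_ge0.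
rewrite -ler_pdivrMr//; apply: ub_le_sup.
  exists `|M| => _ [w w1 <-]; rewrite (le_trans (fM w))//.
  by rewrite (le_trans (ler_norm _))// normrM ler_piMr// ger0_norm ?rnorm_ge0.
exists (sofR k (rnorm v)^-1 *: v) => /=.
  by rewrite /unit_ball /= rnormZR ger0_norm ?invr_ge0 ?rnorm_ge0// mulVf.
by rewrite fZ rnormZR ger0_norm ?invr_ge0 ?rnorm_ge0// mulrC.
Qed.

Lemma opnormP V W (f : {linear V -> W}) : bounded_operators V W f ->
  forall v, rnorm (f v) <= opnorm f * rnorm v.
Proof.
by move=> /continuous_bounded[M fM]; apply: opnorm_bound fM => a v; rewrite linearZ.
Qed.

Lemma opnorm_distP V W (f g : {linear V -> W}) :
  bounded_operators V W f -> bounded_operators V W g ->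
  forall v, rnorm (f v - g v) <= opnorm (fun v => f v - g v) * rnorm v.
Proof.
move=> /continuous_bounded[M fM] /continuous_bounded[N gN].
apply: (@opnorm_bound V W (fun v => f v - g v) (M + N)).
- by move=> a v; rewrite [f _]linearZ_LR [g _]linearZ_LR scalerBr.
- by move=> v; rewrite (le_trans (rnormD _ _))// rnormN mulrDl lerD.
Qed.

Lemma opnorm_eq1 V W (f : {linear V -> W}) v :
  (forall v, rnorm (f v) <= rnorm v) -> rnorm v = 1 -> rnorm (f v) = 1 ->
  opnorm f = 1.
Proof.
move=> f1 v1 fv; have fm w : rnorm (f w) <= 1 * rnorm w by rewrite mul1r.
apply/eqP; rewrite eq_le opnorm_le//=.
by rewrite -fv (le_trans (opnormP (bounded_continuous fm) v))// v1 mulr1.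
Qed.

Lemma dual_sphere_le V (f : {linear V -> K^o}) : dual_sphere V f ->
  forall v, sre `|f v| <= rnorm v.
Proof. by move=> [fb f1] v; rewrite -[leRHS]mul1r -f1; exact: opnormP. Qed.

Lemma bounded_cvg V W (f : {linear V -> W}) (u : nat -> V) v :
  bounded_operators V W f -> u n @[n --> \oo] --> v ->
  f (u n) @[n --> \oo] --> f v.
Proof. by move=> fc; apply: continuous_cvg; exact: fc. Qed.

Lemma rnorm_lim_le V (u : nat -> V) v (B : R) :
  u n @[n --> \oo] --> v -> (forall n, rnorm (u n) <= B) -> rnorm v <= B.
Proof.
move=> /rnorm_cvgP uv uB; apply/ler_addgt0Pr => e e0.
move/cvgrPdist_lt : uv => /(_ _ e0) [N _ /(_ N (leqnn N))] /=.
rewrite sub0r normrN ger0_norm ?rnorm_ge0// rdistC => h.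
by rewrite -(subrKC (u N) v) (le_trans (rnormD _ _))// lerD// ltW.
Qed.

Lemma sre_cvg (u : nat -> K^o) (z : K^o) :
  u n @[n --> \oo] --> z -> sre (u n) @[n --> \oo] --> sre z.
Proof.
move=> /rnorm_cvgP uz; apply/cvgrPdist_lt => e e0.
move/cvgrPdist_lt : uz => /(_ _ e0); apply: filterS => n.
rewrite sub0r normrN ger0_norm ?rnorm_ge0// => h.
by rewrite distrC (le_lt_trans _ h)// -sreB (le_trans (sre_le_norm _)).
Qed.

Lemma series_cvg (Y : completeNormedModType K) (u : nat -> Y) (a : nat -> R) :
  (forall n, rnorm (u n) <= a n) -> cvgn (series a) -> cvgn (series u).
Proof.
move=> ua /cauchy_cvgP/cauchy_seriesP ac.
apply/cauchy_cvgP/cauchy_seriesP => e /gt0_sofR[x [x0 ->]].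
move: (ac _ x0); apply: filterS => -[m n] /=; rewrite -rnorm_lt.
apply: le_lt_trans; rewrite (le_trans (rnorm_sum _ _ _))//.
by rewrite (le_trans _ (ler_norm _))// ler_sum.
Qed.

End opnorm.

(** * Multiplication operators and the integral on [L1] *)

Section L1_operators.
Context (R : realType) (k : scalar_kind) d (T : measurableType d).
Local Notation K := (scalars R k).

Definition scalar_measurable (w : T -> K) : Prop :=
  measurable_fun setT (fun x => sre (w x)) /\
  measurable_fun setT (fun x => sim (w x)).

Lemma scalar_measurableM (w1 w2 : T -> K) :
  scalar_measurable w1 -> scalar_measurable w2 ->
  scalar_measurable (fun x => w1 x * w2 x).
Proof.
move=> [r1 i1] [r2 i2]; split.
  under eq_fun do rewrite sreM.
  by apply: measurable_funB; apply: measurable_funM.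
under eq_fun do rewrite simM.
by apply: measurable_funD; apply: measurable_funM.
Qed.

Lemma scalar_measurable_sofR (p : T -> R) : measurable_fun setT p ->
  scalar_measurable (fun x => sofR k (p x)).
Proof.
move=> mp; split; first by under eq_fun do rewrite sre_sofR.
by under eq_fun do rewrite sim_sofR; exact: measurable_cst.
Qed.

Lemma scalar_measurable_norm (w : T -> K) : scalar_measurable w ->
  measurable_fun setT (fun x => sre `|w x|).
Proof. by move=> [mr mi]; exact: measurable_sre_norm. Qed.

Lemma scalar_measurableV (w : T -> K) : scalar_measurable w ->
  scalar_measurable (fun x => (w x)^-1).
Proof.
move=> [mr mi].
have mV : measurable_fun setT (fun x => (sre (w x) ^+ 2 + sim (w x) ^+ 2)^-1).
  under eq_fun do rewrite -powR_inv1 ?addr_ge0 ?sqr_ge0//.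
  apply: (measurableT_comp (measurable_powR _)).
  by apply: measurable_funD; apply: measurable_funX.
split.
  under eq_fun do rewrite sreV.
  exact: measurable_funM.
under eq_fun do rewrite simV.
by apply: measurable_funM => //; apply: measurableT_comp.
Qed.

(** Multiplication by a function of modulus at most 1 is a contraction of [L_1]. Two kinds occur:
    indicators, which give restrictions, and the phase of a function. *)
Record multiplier := Multiplier {
  mult_fun :> T -> K ;
  mult_meas : scalar_measurable mult_fun ;
  mult_le1 : forall x, sre `|mult_fun x| <= 1 }.

Context (mu : {measure set T -> \bar R}).
Local Notation X := (L1 k mu).

Lemma L1fun_meas (f : L1fun k mu) : scalar_measurable f.
Proof. by case: f => f /=; rewrite inE => -[]. Qed.

Lemma L1fun_int (f : L1fun k mu) :
  (\int[mu]_x (sre (`|f x| : K))%:E < +oo)%E.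
Proof. by case: f => f /=; rewrite inE => -[]. Qed.

Lemma L1fun_intro (f : T -> K) (g : T -> R) : scalar_measurable f ->
  measurable_fun setT g ->
  (\int[mu]_x (g x)%:E < +oo)%E -> (forall x, sre `|f x| <= g x) ->
  (f : T -> K^o) \in integrable_pred mu.
Proof.
move=> [mr mi] mg goo fg; rewrite inE; split => //.
apply: le_lt_trans goo; apply: ge0_le_integral => //.
- by move=> x _; rewrite lee_fin sre_norm_ge0.
- by apply/measurable_EFinP; exact: measurable_sre_norm.
- exact/measurable_EFinP.
- by move=> x _; rewrite lee_fin.
Qed.

Lemma mul_L1funP (w : multiplier) (f : L1fun k mu) :
  ((fun x => w x * f x) : T -> K^o) \in integrable_pred mu.
Proof.
apply: (L1fun_intro _ _ (L1fun_int f)).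
- by apply: scalar_measurableM; [exact: mult_meas|exact: L1fun_meas].
- by apply: scalar_measurable_norm; exact: L1fun_meas.
- by move=> x; rewrite normrM sre_normM ler_piMl ?sre_norm_ge0 ?mult_le1.
Qed.

Definition mul_L1fun w f : L1fun k mu := MkL1fun (mul_L1funP w f).

Lemma L1class_eq (f g : L1fun k mu) : f =1 g -> L1class f = L1class g.
Proof. by move=> fg; apply/L1classP; apply: aeW => x. Qed.

Lemma L1class_scaler (a : K) (f : L1fun k mu) :
  L1class (a *: f) = a *: (L1class f : X).
Proof. exact: L1class_scale. Qed.

Lemma rnorm_L1class (f : L1fun k mu) :
  rnorm (L1class f : X) = \int[mu]_x sre (`|f x| : K).
Proof. by rewrite -[RHS](sre_sofR k) -L1norm_class. Qed.

Definition Lmul (w : multiplier) (u : X) : X := L1class (mul_L1fun w (L1repr u)).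

Lemma Lmul_class w (f : L1fun k mu) : Lmul w (L1class f) = L1class (mul_L1fun w f).
Proof.
apply/L1classP.
have /L1classP : L1class (L1repr (L1class f)) = L1class f by rewrite L1reprK.
by apply: filterS => x /= ->.
Qed.

Lemma Lmul_linear w : linear (Lmul w).
Proof.
move=> a u v; rewrite -[u]L1reprK -[v]L1reprK.
rewrite -L1class_scaler -L1class_add !Lmul_class.
rewrite -L1class_scaler -L1class_add; apply: L1class_eq => x /=.
change (w x * (a * L1repr u x + L1repr v x) =
  a * (w x * L1repr u x) + w x * L1repr v x).
by rewrite mulrDr mulrCA.
Qed.

HB.instance Definition _ w := @GRing.isLinear.Build K X X _ (Lmul w)
  (Lmul_linear w).

Lemma rnorm_Lmul w u : rnorm (Lmul w u) <= rnorm u.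
Proof.
rewrite -[u]L1reprK Lmul_class !rnorm_L1class.
apply: le_Rintegral => //; [exact: L1fun_integrable_norm..|].
by move=> x _ /=; rewrite normrM sre_normM ler_piMl ?sre_norm_ge0 ?mult_le1.
Qed.

Lemma L1fun_integrable_sre (f : L1fun k mu) :
  mu.-integrable setT (EFin \o (fun x => sre (f x : K))).
Proof.
have [mr mi] := L1fun_meas f.
apply: le_integrable (L1fun_integrable_norm f) => //; first exact/measurable_EFinP.
move=> x _ /=; rewrite lee_fin [leRHS]ger0_norm ?sre_norm_ge0//.
exact: sre_le_norm.
Qed.

Lemma L1fun_integrable_sim (f : L1fun k mu) :
  mu.-integrable setT (EFin \o (fun x => sim (f x : K))).
Proof.
have [mr mi] := L1fun_meas f.
apply: le_integrable (L1fun_integrable_norm f) => //; first exact/measurable_EFinP.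
move=> x _ /=; rewrite lee_fin [leRHS]ger0_norm ?sre_norm_ge0//.
exact: sim_le_norm.
Qed.

Lemma sim_Rintegral (f : T -> K) :
  sim (smk k 0 (\int[mu]_x sim (f x))) = \int[mu]_x sim (f x).
Proof.
rewrite /smk /sim; case: (k) f => // f.
by rewrite /Rintegral integral0.
Qed.

Definition L1int (u : X) : K^o :=
  smk k (\int[mu]_x sre (L1repr u x : K)) (\int[mu]_x sim (L1repr u x : K)).

Lemma sre_L1int_class (f : L1fun k mu) :
  sre (L1int (L1class f)) = \int[mu]_x sre (f x : K).
Proof.
rewrite sre_smk; congr fine; apply: ae_eq_integral => //.
- exact: (measurable_int mu (L1fun_integrable_sre _)).
- exact: (measurable_int mu (L1fun_integrable_sre _)).
have /L1classP : L1class (L1repr (L1class f)) = L1class f by rewrite L1reprK.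
by apply: filterS => x -> _.
Qed.

Lemma sim_L1int_class (f : L1fun k mu) :
  sim (L1int (L1class f)) = \int[mu]_x sim (f x : K).
Proof.
transitivity (\int[mu]_x sim (L1repr (L1class f) x : K)).
  rewrite -[RHS]sim_Rintegral /L1int; move: (Rintegral _ _ _) => a.
  by move: (Rintegral _ _ _) => b; rewrite /smk; case: (k).
congr fine; apply: ae_eq_integral => //.
- exact: (measurable_int mu (L1fun_integrable_sim _)).
- exact: (measurable_int mu (L1fun_integrable_sim _)).
have /L1classP : L1class (L1repr (L1class f)) = L1class f by rewrite L1reprK.
by apply: filterS => x -> _.
Qed.

Lemma L1int_linear : linear (L1int : X -> K^o).
Proof.
move=> a u v; rewrite -[u]L1reprK -[v]L1reprK.
move: (L1repr u) (L1repr v) => f g.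
rewrite -L1class_scaler -L1class_add.
have ir h (c : R) : mu.-integrable setT
    (EFin \o (fun x => c * sre ((h : L1fun k mu) x : K))).
  exact: (integrableZl measurableT c (L1fun_integrable_sre h)).
have ii h (c : R) : mu.-integrable setT
    (EFin \o (fun x => c * sim ((h : L1fun k mu) x : K))).
  exact: (integrableZl measurableT c (L1fun_integrable_sim h)).
apply: scalar_ext; rewrite ?(sreD, simD) ?(sreM, simM).
- rewrite !sre_L1int_class sim_L1int_class.
  rewrite -!RintegralZl ?L1fun_integrable_sre ?L1fun_integrable_sim//.
  rewrite -RintegralB// -RintegralD//; last first.
  + exact: L1fun_integrable_sre.
  + exact: (integrableB measurableT (ir f (sre a)) (ii f (sim a))).
  apply: eq_Rintegral => x _; rewrite -sreM -sreD.
  by [].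
- rewrite !sim_L1int_class sre_L1int_class.
  rewrite -!RintegralZl ?L1fun_integrable_sre ?L1fun_integrable_sim//.
  rewrite -RintegralD// -RintegralD//; last first.
  + exact: L1fun_integrable_sim.
  + exact: (integrableD measurableT (ii f (sre a)) (ir f (sim a))).
  apply: eq_Rintegral => x _; rewrite -simM -simD.
  by [].
Qed.

HB.instance Definition _ := @GRing.isLinear.Build K X K^o _ L1int L1int_linear.

(* With [z] the integral, [|z|^2 = \int (Re z Re f + Im z Im f) <= |z| \int |f|]
   by the Cauchy-Schwarz inequality in the plane. *)
Lemma norm_L1int (u : X) : sre `|L1int u| <= rnorm u.
Proof.
rewrite -[u]L1reprK; move: (L1repr u) => f; rewrite rnorm_L1class sre_norm.
rewrite sre_L1int_class sim_L1int_class.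
set a := Rintegral _ _ _; set b := Rintegral _ _ _; set c := Rintegral _ _ _.
have c0 : 0 <= c by apply: Rintegral_ge0 => x _; exact: sre_norm_ge0.
set s := Num.sqrt _; have s0 : 0 <= s by exact: sqrtr_ge0.
have [->//|sN0] := eqVneq s 0.
have sp : 0 < s by rewrite lt_neqAle eq_sym sN0.
have s2 : s * s = a * a + b * b.
  by rewrite -expr2 sqr_sqrtr ?addr_ge0 ?sqr_ge0// !expr2.
rewrite -(ler_pM2l sp) s2 /a /b /c.
have ir := L1fun_integrable_sre f; have ii := L1fun_integrable_sim f.
have iN := L1fun_integrable_norm f.
rewrite -/a -/b -!RintegralZl// -RintegralD//; last 2 first.
- exact: (integrableZl measurableT a ir).
- exact: (integrableZl measurableT b ii).
apply: le_Rintegral => //.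
- exact: (integrableD measurableT (integrableZl measurableT a ir)
    (integrableZl measurableT b ii)).
- exact: (integrableZl measurableT s iN).
move=> x _; rewrite sre_norm /s -sqrtrM ?addr_ge0 ?sqr_ge0//.
move: (sre _) (sim _) => p q; rewrite (le_trans (ler_norm _))// -sqrtr_sqr.
rewrite ler_sqrt ?mulr_ge0 ?addr_ge0 ?sqr_ge0//.
rewrite -subr_ge0 (_ : _ - _ = (a * q - b * p) ^+ 2) ?sqr_ge0//.
by ring.
Qed.

(** The real part of the integral is already the norm, and [norm_L1int] then leaves no room for an
    imaginary part. *)
Lemma L1int_sofR (f : L1fun k mu) (p : T -> R) : (forall x, 0 <= p x) ->
  (forall x, f x = sofR k (p x)) -> L1int (L1class f) = sofR k (rnorm (L1class f : X)).
Proof.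
move=> p0 fp; apply: sre_norm_eq; last exact: norm_L1int.
rewrite sre_L1int_class rnorm_L1class; apply: eq_Rintegral => x _.
by rewrite fp norm_sofR !sre_sofR ger0_norm.
Qed.

End L1_operators.

(** * Restriction to measurable sets *)

Section restriction.
Context (R : realType) (k : scalar_kind) d (T : measurableType d)
  (mu : {measure set T -> \bar R}).
Local Notation K := (scalars R k).
Local Notation X := (L1 k mu).
Implicit Types (u v : X) (E F : set T).

(* Identically [0] when [E] is not measurable, so that restriction is a total
   operation on sets. *)
Definition meas_indic E (x : T) : R :=
  if `[< measurable E >] then \1_E x else 0.

Lemma measurable_meas_indic E : measurable_fun setT (meas_indic E).
Proof. by rewrite /meas_indic; case: asboolP => // mE; exact: measurable_indic. Qed.

Lemma indic_multiplier_le1 E x : sre `|sofR k (meas_indic E x)| <= 1.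
Proof.
rewrite norm_sofR sre_sofR /meas_indic; case: asboolP => _; last by rewrite normr0.
by rewrite indicE; case: (_ \in _); rewrite ?normr0 ?normr1.
Qed.

Definition indic_multiplier E : multiplier R k T := Multiplier
  (scalar_measurable_sofR k (measurable_meas_indic E)) (indic_multiplier_le1 E).

Local Notation restr E := (Lmul (indic_multiplier E)).

Lemma indic_multiplierE E x : measurable E ->
  indic_multiplier E x = if x \in E then 1 else 0.
Proof.
move=> mE; rewrite /= /meas_indic asboolT// indicE.
by case: (_ \in _); rewrite ?sofR1 ?sofR0.
Qed.

(** The finite measure [|u| mu]. Its additivity is the additivity of the norm over disjoint
    restrictions, and it is the control measure given to the Radon-Nikodym property. *)
Definition L1measure (u : X) (E : set T) : \bar R :=
  (\int[mu]_(x in E) (sre `|L1repr u x : K|)%:E)%E.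

Let L1measure0 u : L1measure u set0 = 0%E.
Proof. by rewrite /L1measure integral_set0. Qed.

Let L1measure_ge0 u E : (0 <= L1measure u E)%E.
Proof. by apply: integral_ge0 => x _; rewrite lee_fin sre_norm_ge0. Qed.

Let L1measure_sigma_additive u : semi_sigma_additive (L1measure u).
Proof.
move=> F mF tF mUF; rewrite /L1measure ge0_integral_bigcup//.
- by apply: is_cvg_ereal_nneg_natsum_cond => n _ _; exact: L1measure_ge0.
- apply/measurable_EFinP; apply: measurable_funTS.
  by apply: scalar_measurable_norm; exact: L1fun_meas.
- by move=> x _; rewrite lee_fin sre_norm_ge0.
Qed.

HB.instance Definition _ u := isMeasure.Build d T R (L1measure u)
  (L1measure0 u) (@L1measure_ge0 u) (@L1measure_sigma_additive u).

Lemma rnorm_restr u E : measurable E -> (rnorm (restr E u))%:E = L1measure u E.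
Proof.
move=> mE; rewrite /Lmul rnorm_L1class /Rintegral fineK.
  rewrite /L1measure [RHS]integral_mkcond; apply: eq_integral => x _.
  rewrite /mul_L1fun /patch; cbn [L1fun_val]; rewrite indic_multiplierE//.
  by case: (_ \in _); rewrite ?mul1r// mul0r normr0 sre0.
apply: integrable_fin_num => //; exact: L1fun_integrable_norm.
Qed.

Let L1measure_fin u : fin_num_fun (L1measure u).
Proof. by move=> E mE; rewrite -rnorm_restr. Qed.

HB.instance Definition _ u := Measure_isFinite.Build d T R (L1measure u)
  (@L1measure_fin u).

Lemma Lmul_comp (w1 w2 w3 : multiplier R k T) u :
  (forall x, w1 x * w2 x = w3 x) -> Lmul w1 (Lmul w2 u) = Lmul w3 u.
Proof.
move=> w123; rewrite -[u]L1reprK !Lmul_class; apply: L1class_eq => x /=.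
by rewrite mulrA w123.
Qed.

Lemma restrI E F u : measurable E -> measurable F ->
  restr E (restr F u) = restr (E `&` F) u.
Proof.
move=> mE mF; apply: Lmul_comp => x; rewrite !indic_multiplierE//; last exact: measurableI.
by rewrite in_setI; do 2 case: (_ \in _); rewrite ?mulr1 ?mulr0.
Qed.

Lemma restrU E F u : measurable E -> measurable F -> E `&` F = set0 ->
  restr (E `|` F) u = restr E u + restr F u.
Proof.
move=> mE mF EF0; rewrite -[u]L1reprK !Lmul_class -L1class_add.
apply: L1class_eq => x /=.
change (indic_multiplier (E `|` F) x * L1repr u x =
  indic_multiplier E x * L1repr u x + indic_multiplier F x * L1repr u x).
rewrite !indic_multiplierE//; last exact: measurableU.
have : ~~ ((x \in E) && (x \in F)) by rewrite -in_setI EF0 in_set0.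
by rewrite in_setU; do 2 case: (_ \in _); rewrite ?mul1r ?mul0r ?addr0 ?add0r.
Qed.

Lemma restrT u : restr setT u = u.
Proof.
rewrite -{1}[u]L1reprK Lmul_class -[RHS]L1reprK; apply: L1class_eq => x.
rewrite /mul_L1fun; cbn [L1fun_val]; rewrite indic_multiplierE// in_setT.
by rewrite mul1r.
Qed.

Lemma restr_null E u : measurable E -> mu E = 0%E -> restr E u = 0.
Proof.
move=> mE E0; apply: rnorm_eq0; apply: EFin_inj; rewrite rnorm_restr//.
apply: null_set_integral => //; apply/measurable_EFinP; apply: measurable_funTS.
by apply: scalar_measurable_norm; exact: L1fun_meas.
Qed.

Lemma restr0 u : restr set0 u = 0.
Proof. by apply: restr_null; rewrite ?measure0. Qed.

Lemma restrC E u : measurable E -> restr (~` E) u = u - restr E u.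
Proof.
move=> mE; have := restrU u mE (measurableC mE) (setICr E).
by rewrite setUv restrT => {2}->; rewrite addrAC subrr add0r.
Qed.

Lemma rnorm_restrC E u : measurable E ->
  rnorm (restr E u) + rnorm (restr (~` E) u) = rnorm u.
Proof.
move=> mE; have mC := measurableC mE; apply: EFin_inj.
rewrite EFinD !rnorm_restr// -[u in RHS]restrT rnorm_restr//.
by rewrite -measureU ?setUv ?setICr.
Qed.

Lemma rnorm_restr_le E F u : measurable E -> measurable F -> E `<=` F ->
  rnorm (restr E u) <= rnorm (restr F u).
Proof.
move=> mE mF EF; rewrite -lee_fin !rnorm_restr//.
by apply: le_measure => //; rewrite inE.
Qed.

Lemma restr_bigsetU (F : nat -> set T) (P : pred nat) n u :
  (forall i, measurable (F i)) -> trivIset setT F ->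
  restr (\big[setU/set0]_(i < n | P i) F i) u = \sum_(i < n | P i) restr (F i) u.
Proof.
move=> mF tF; rewrite [in LHS]big_mkcond [RHS]big_mkcond /=.
elim: n => [|n IH]; first by rewrite !big_ord0 restr0.
rewrite !big_ord_recr /= -IH; case: (P n); last by rewrite setU0 addr0.
rewrite restrU//; first by apply: bigsetU_measurable => i _; case: ifP.
rewrite setIC big_distrr/= big1// => i _; case: ifP => _; last exact: setI0.
by move/trivIsetP : tF; apply => //=; rewrite gtn_eqF.
Qed.

Lemma rnorm_restr_bigsetU (F : nat -> set T) (P : pred nat) n u :
  (forall i, measurable (F i)) -> trivIset setT F ->
  rnorm (restr (\big[setU/set0]_(i < n | P i) F i) u) =
  \sum_(i < n | P i) rnorm (restr (F i) u).
Proof.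
move=> mF tF; apply: EFin_inj; rewrite rnorm_restr; last exact: bigsetU_measurable.
rewrite -sumEFin (eq_bigr (fun i : 'I_n => L1measure u (F i))); last first.
  by move=> i _; rewrite rnorm_restr.
apply: measure_bigsetU_ord_cond => //; apply/trivIsetP => i j _ _ ij.
by move/trivIsetP : tF; apply.
Qed.

Lemma rnorm_restr_cvg (F : nat -> set T) u :
  (forall i, measurable (F i)) -> trivIset setT F ->
  \sum_(i < n) rnorm (restr (F i) u) @[n --> \oo] --> rnorm (restr (\bigcup_n F n) u).
Proof.
move=> mF tF; have mU := bigcup_measurable (fun i (_ : setT i) => mF i).
have h := @measure_semi_sigma_additive _ _ _ (L1measure u) F mF tF mU.
apply: (@fine_cvg _ _ _ _ (fun n => (\sum_(i < n) rnorm (restr (F i) u))%:E)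
  (rnorm (restr (\bigcup_n F n) u))).
rewrite rnorm_restr//; apply: cvg_trans h; apply: near_eq_cvg; near=> n.
by rewrite big_mkord -sumEFin; apply: eq_bigr => i _; rewrite rnorm_restr.
Unshelve. all: by end_near. Qed.

(** The norm of the remainder is exactly the difference of the norms, so convergence in norm reduces
    to countable additivity of [L1measure u]. *)
Lemma restr_cvg (F : nat -> set T) u :
  (forall i, measurable (F i)) -> trivIset setT F ->
  \sum_(i < n) restr (F i) u @[n --> \oo] --> restr (\bigcup_n F n) u.
Proof.
move=> mF tF; have mU := bigcup_measurable (fun i (_ : setT i) => mF i).
apply/rnorm_cvgP; pose G n := \big[setU/set0]_(i < n) F i.
have mG n : measurable (G n) by exact: bigsetU_measurable.
have GU n : G n `<=` \bigcup_i F i by rewrite /G -bigcup_mkord => x [i _ Fx]; exists i.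
have GD n : G n `&` ((\bigcup_i F i) `\` G n) = set0.
  by rewrite setDE setICA setICr setI0.
have UE n : \bigcup_i F i = G n `|` ((\bigcup_i F i) `\` G n) by rewrite setDUK.
have mD n : measurable ((\bigcup_i F i) `\` G n) by exact: measurableD.
have sE n : rnorm (\sum_(i < n) restr (F i) u - restr (\bigcup_i F i) u) =
    rnorm (restr (\bigcup_i F i) u) - \sum_(i < n) rnorm (restr (F i) u).
  rewrite -(restr_bigsetU xpredT n u mF tF).
  rewrite -(rnorm_restr_bigsetU xpredT n u mF tF) -/(G n).
  rewrite {1}(UE n) restrU// opprD addNKr rnormN; apply/eqP.
  rewrite eq_sym subr_eq addrC; apply/eqP; apply: EFin_inj.
  by rewrite EFinD !rnorm_restr// -measureU// -UE.
have h : rnorm (restr (\bigcup_i F i) u) - \sum_(i < n) rnorm (restr (F i) u)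
    @[n --> \oo] --> rnorm (restr (\bigcup_i F i) u) - rnorm (restr (\bigcup_i F i) u).
  by apply: cvgB; [exact: cvg_cst|exact: rnorm_restr_cvg].
by move: h; rewrite subrr; apply: cvg_trans; apply: near_eq_cvg; near=> n; rewrite sE.
Unshelve. all: by end_near. Qed.

(** The triangle inequality over the pieces loses nothing, because the norms of the restrictions add
    up to at most the norm of the whole. The term in [v] leaves room for an error proportional to a
    second, fixed function. *)
Lemma countable_pieces (Y : normedModType K) (P : {linear X -> Y}) (c c' : R)
    (F : nat -> set T) u v : bounded_operators X Y P -> 0 <= c -> 0 <= c' ->
  (forall i, measurable (F i)) -> trivIset setT F ->
  (forall i, rnorm (P (restr (F i) u)) <=
     c * rnorm (restr (F i) u) + c' * rnorm (restr (F i) v)) ->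
  rnorm (P (restr (\bigcup_i F i) u)) <= c * rnorm u + c' * rnorm v.
Proof.
move=> bP c0 c'0 mF tF PF.
have h := bounded_cvg bP (@restr_cvg F u mF tF).
apply: (rnorm_lim_le h) => n.
rewrite linear_sum (le_trans (rnorm_sum _ _ _))//.
rewrite (le_trans (ler_sum _ (fun (i : 'I_n) _ => PF i)))// big_split -!mulr_sumr.
rewrite -(rnorm_restr_bigsetU xpredT n u mF tF).
rewrite -(rnorm_restr_bigsetU xpredT n v mF tF).
by rewrite lerD// ler_wpM2l// rnorm_Lmul.
Qed.

End restriction.

Notation restr E := (Lmul (indic_multiplier _ _ E)).

(** * Dense scalars and bounds on the support of a function *)

Lemma norm_le_sre_sim (R : realType) (k : scalar_kind) (z : scalars R k) :
  sre `|z| <= `|sre z| + `|sim z|.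
Proof.
rewrite sre_norm -[leRHS]ger0_norm ?addr_ge0// -sqrtr_sqr.
rewrite ler_sqrt ?sqr_ge0//.
rewrite -(real_normK (num_real (sre z))) -(real_normK (num_real (sim z))).
by rewrite sqrrD lerD2r lerDl mulrn_wge0// mulr_ge0.
Qed.

Definition scalar_seq (R : realType) (k : scalar_kind) (i : nat) : scalars R k :=
  if unpickle i is Some (a, b) then smk k (ratr (a : rat)) (ratr (b : rat)) else 0.

Lemma scalar_seq_dense (R : realType) (k : scalar_kind) (z : scalars R k) (e : R) :
  0 < e -> exists i, sre `|z - scalar_seq R k i| < e.
Proof.
move=> e0; have dense x : exists q : rat, `|x - ratr q| < e / 2.
  have /rat_in_itvoo[q] : x - e / 2 < x + e / 2 by lra.
  rewrite in_itv /= => /andP[q1 q2]; exists q.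
  by rewrite ltr_norml; apply/andP; split; lra.
have [a ha] := dense (sre z); have [b hb] := dense (sim z).
exists (pickle (a, b)); rewrite /scalar_seq pickleK.
rewrite (le_lt_trans (norm_le_sre_sim _))// [e]splitr sreB simB sre_smk ltr_leD//.
case: (k) z hb {ha} => z hb; last by rewrite /= ltW.
by rewrite /= subr0 normr0 divr_ge0// ltW.
Qed.

Section density.
Context (R : realType) (k : scalar_kind) d (T : measurableType d)
  (mu : {measure set T -> \bar R}).
Local Notation K := (scalars R k).
Local Notation X := (L1 k mu).

Lemma rnorm_L1class_le (f g : L1fun k mu) (a : R) :
  (forall x, sre (`|f x| : K) <= a * sre (`|g x| : K)) ->
  rnorm (L1class f : X) <= a * rnorm (L1class g : X).
Proof.
move=> fg; rewrite !rnorm_L1class -RintegralZl//; last exact: L1fun_integrable_norm.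
apply: le_Rintegral => //; first exact: L1fun_integrable_norm.
exact: (integrableZl measurableT a (L1fun_integrable_norm g)).
Qed.

Definition L1support (f : X) : set T := [set x | L1repr f x != 0 :> K].

Lemma measurable_L1support f : measurable (L1support f).
Proof.
have -> : L1support f = (fun x => sre `|L1repr f x : K|) @^-1` (~` [set 0]).
  apply/seteqP; split => x /=; rewrite /L1support /=.
    by move/eqP => h h0; apply: h; apply/eqP; rewrite -normr_eq0 -sofR_norm h0 sofR0.
  by move=> h; apply/eqP => h0; apply: h; rewrite h0 normr0 sre0.
rewrite -[X in measurable X]setTI; apply: (scalar_measurable_norm (L1fun_meas _)) => //.
by apply: measurableC; exact: measurable_set1.
Qed.

(* On the support of [f], every [h] is approximated by [v_i f] on the sets where
   the quotient [h / f] is close to the [i]-th term [v_i] of a dense sequence. *)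
Lemma bound_on_support (Y : normedModType K) (P : {linear X -> Y}) (f : X) (c : R) :
  bounded_operators X Y P -> 0 <= c ->
  (forall E, measurable E -> rnorm (P (restr E f)) <= c * rnorm (restr E f)) ->
  forall h, rnorm (P (restr (L1support f) h)) <= c * rnorm h.
Proof.
move=> bP c0 Pc h; have [M' PM'] := continuous_bounded bP; pose M := `|M'|.
have PM v : rnorm (P v) <= M * rnorm v.
  by rewrite (le_trans (PM' v))// ler_wpM2r ?rnorm_ge0// ler_norm.
have M0 : 0 <= M by exact: normr_ge0.
apply/ler_addgt0Pr => e e0.
(* The errors on the pieces will add up to at most [(c + M) * g * rnorm f]; the [+ 1] keeps the
   denominator positive. *)
pose g := e / ((c + M) * rnorm f + 1).
have den0 : 0 < (c + M) * rnorm f + 1.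
  by rewrite ltr_wpDl// mulr_ge0 ?rnorm_ge0// addr_ge0.
have g0 : 0 < g by exact: divr_gt0.
pose q x : K := L1repr h x * (L1repr f x)^-1.
have mq : scalar_measurable q.
  by apply: scalar_measurableM; [|apply: scalar_measurableV]; exact: L1fun_meas.
pose C i := [set x | sre `|q x - scalar_seq R k i| < g].
have mC i : measurable (C i).
  have mqi : scalar_measurable (fun x => q x - scalar_seq R k i).
    case: mq => mr mi; split.
      by under eq_fun do rewrite sreB; exact: measurable_funB.
    by under eq_fun do rewrite simB; exact: measurable_funB.
  rewrite -[C i]setTI.
  have -> : C i = (fun x => sre `|q x - scalar_seq R k i|) @^-1` `]-oo, g[.
    by apply/seteqP; split => x /=; rewrite in_itv.
  by apply: (scalar_measurable_norm mqi).
have mU := measurable_L1support f.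
(* Where [f] vanishes the quotient [q] has the default value 0 and says nothing about [h]; the
   intersection with the support discards these points. *)
pose F i := seqDU C i `&` L1support f.
have mF i : measurable (F i).
  apply: measurableI => //; apply: measurableD => //.
  by apply: bigsetU_measurable => j _.
have tF : trivIset setT F.
  apply/trivIsetP => i j _ _ ij; rewrite /F setIACA.
  by have /trivIsetP -> := @trivIset_seqDU _ C; rewrite ?set0I.
have UF : \bigcup_i F i = L1support f.
  rewrite /F -setI_bigcupl -seqDU_bigcup_eq; apply/setIidr => x _.
  by have [i qi] := scalar_seq_dense (q x) g0; exists i.
have close i : rnorm (restr (F i) h - scalar_seq R k i *: restr (F i) f) <=
    g * rnorm (restr (F i) f).
  rewrite -[h]L1reprK -[f in X in X <= _]L1reprK -[f in X in _ <= X]L1reprK.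
  rewrite -scaleNr !Lmul_class -L1class_scaler -L1class_add.
  apply: rnorm_L1class_le => x.
  change (sre `|indic_multiplier R k (F i) x * L1repr h x +
    - scalar_seq R k i * (indic_multiplier R k (F i) x * L1repr f x)| <=
    g * sre `|indic_multiplier R k (F i) x * L1repr f x|).
  rewrite !indic_multiplierE//; case: (boolP (x \in F i)) => [|_]; last first.
    by rewrite !mul0r mulr0 addr0 normr0 sre0 mulr0.
  rewrite inE => -[[Cx _] /= fx].
  rewrite !mul1r -(divfK fx (L1repr h x)) -mulrDl normrM sre_normM.
  by rewrite ler_wpM2r ?sre_norm_ge0// ltW.
(* The hypothesis bounds [P] by [c] on the multiple [v] of a restriction of [f]; the small remainder
   only has the crude bound [M]. *)
have piece i : rnorm (P (restr (F i) h)) <=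
    c * rnorm (restr (F i) h) + (c + M) * g * rnorm (restr (F i) f).
  set v := scalar_seq R k i *: restr (F i) f.
  have -> : P (restr (F i) h) = P v + P (restr (F i) h - v) by rewrite linearB subrKC.
  have h1 : rnorm (P v) <= c * rnorm v.
    rewrite linearZ_LR !rnormZ mulrCA ler_wpM2l ?sre_norm_ge0//.
    exact: Pc.
  have h2 : rnorm v <= rnorm (restr (F i) h) + g * rnorm (restr (F i) f).
    rewrite -[v](subKr (restr (F i) h)) (le_trans (rnormD _ _))// lerD// rnormN.
    exact: close.
  have h3 := le_trans (PM (restr (F i) h - v)) (ler_wpM2l M0 (close i)).
  have h4 := ler_wpM2l c0 h2.
  rewrite (le_trans (rnormD _ _))//; move: h1 h3 h4; lra.
have := @countable_pieces _ _ _ _ _ _ P c ((c + M) * g) F h f bP c0 _ mF tF piece.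
rewrite UF => H; apply: (le_trans (H _)).
  by rewrite mulr_ge0 ?addr_ge0// ltW.
rewrite lerD2l (_ : _ * rnorm f =
    e * ((c + M) * rnorm f / ((c + M) * rnorm f + 1))); last by rewrite /g; ring.
by rewrite ler_piMr ?(ltW e0)// ler_pdivrMr// mul1r lerDl.
Qed.

End density.

(** * Infinite dimensional [L1] and disjoint sets *)

Lemma smk_eta (R : realType) (k : scalar_kind) (z : scalars R k) :
  smk k (sre z) (sim z) = z.
Proof. by apply: scalar_ext; rewrite ?sre_smk ?sim_smk_sim. Qed.

Section disjoint_sets.
Context (R : realType) (k : scalar_kind) d (T : measurableType d)
  (mu : {measure set T -> \bar R}).
Local Notation K := (scalars R k).
Local Notation X := (L1 k mu).

Lemma zero_integral_negligible (F : set T) (h : T -> R) : measurable F ->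
  mu.-integrable F (EFin \o h) -> \int[mu]_(x in F) h x = 0 ->
  mu.-negligible (F `&` [set x | h x < 0]) ->
  mu.-negligible (F `&` [set x | h x != 0]).
Proof.
move=> mF ih h0 hneg; have mh := measurable_int mu ih.
have : (\int[mu]_(x in F) `|(EFin \o h) x| = 0)%E.
  transitivity (\int[mu]_(x in F) (h x)%:E)%E; last first.
    by rewrite -[LHS]fineK ?integrable_fin_num//; exact: (congr1 EFin h0).
  apply: ae_eq_integral => //; first exact: measurableT_comp.
  apply: negligibleS hneg => x /not_implyP[Fx hx]; split => //=.
  by rewrite ltNge; apply/negP => hx0; apply: hx; rewrite /= ger0_norm.
move/(ae_eq_integral_abs mu mF mh); apply: negligibleS => x [Fx /eqP hx].
by apply/not_implyP; split => // -[].
Qed.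

(** Let [c] be the mean of [g] over the atom. If [g > c] or [g < c] holds almost everywhere, then
    [g - c] has constant sign and integral 0, so it vanishes. Otherwise the atom makes both sets
    null. *)
Lemma atom_constant (F : set T) (g : T -> R) : measurable F ->
  (0 < mu F)%E -> (mu F < +oo)%E ->
  (forall G, measurable G -> G `<=` F -> mu G = 0%E \/ mu (F `\` G) = 0%E) ->
  mu.-integrable F (EFin \o g) ->
  exists c, mu.-negligible (F `&` [set x | g x != c]).
Proof.
move=> mF F0 Foo atom ig.
have mg : measurable_fun F g by apply/measurable_EFinP; exact: measurable_int ig.
have F0' : fine (mu F) != 0.
  by rewrite gt_eqF// fine_gt0// F0 Foo.
pose c := \int[mu]_(x in F) g x / fine (mu F); exists c.
have ic : mu.-integrable F (EFin \o cst c).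
  apply: measurable_bounded_integrable => //.
  by exists `|c|; split => // M cM x _; exact: ltW.
have int0 : \int[mu]_(x in F) (g x - c) = 0.
  by rewrite RintegralB// Rintegral_cst// /c divfK// subrr.
have int0' : \int[mu]_(x in F) (c - g x) = 0.
  by rewrite RintegralB// Rintegral_cst// /c divfK// subrr.
have mA : measurable (F `&` [set x | c < g x]).
  rewrite (_ : [set x | _] = g @^-1` `]c, +oo[); first by apply: mg => //.
  by apply/seteqP; split => x /=; rewrite in_itv /= andbT.
have mB : measurable (F `&` [set x | g x < c]).
  rewrite (_ : [set x | _] = g @^-1` `]-oo, c[); first by apply: mg => //.
  by apply/seteqP; split => x /=; rewrite in_itv.
case: (atom _ mA (@subIsetl _ _ _)) => A0; last first.
  have : mu.-negligible (F `&` [set x | g x - c != 0]).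
    apply: zero_integral_negligible => //; first exact: (integrableB mF ig ic).
    apply: negligibleS (_ : mu.-negligible (F `\` (F `&` [set x | c < g x]))).
      by move=> x [Fx /= gx]; split => // -[_] /=; move: gx; lra.
    by apply/negligibleP => //; exact: measurableD.
  by apply: negligibleS => x [Fx /= gc]; split => //=; rewrite subr_eq0.
case: (atom _ mB (@subIsetl _ _ _)) => B0; last first.
  have : mu.-negligible (F `&` [set x | c - g x != 0]).
    apply: zero_integral_negligible => //; first exact: (integrableB mF ic ig).
    apply: negligibleS (_ : mu.-negligible (F `\` (F `&` [set x | g x < c]))).
      by move=> x [Fx /= gx]; split => // -[_] /=; move: gx; lra.
    by apply/negligibleP => //; exact: measurableD.
  by apply: negligibleS => x [Fx /= gc]; split => //=; rewrite subr_eq0 eq_sym.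
apply: negligibleS (negligibleU (proj2 (negligibleP mu mA) A0)
  (proj2 (negligibleP mu mB) B0)).
by move=> x [Fx /=]; rewrite neq_lt => /orP[]; [right|left].
Qed.

Lemma indic_L1funP (F : set T) : measurable F -> (mu F < +oo)%E ->
  ((fun x => sofR k (\1_F x)) : T -> K^o) \in integrable_pred mu.
Proof.
move=> mF Foo; apply: (@L1fun_intro _ _ _ _ _ _ (\1_F)).
- by apply: scalar_measurable_sofR; exact: measurable_indic.
- exact: measurable_indic.
- by rewrite integral_indic// setIT.
- by move=> x; rewrite norm_sofR sre_sofR indicE ger0_norm ?ler0n.
Qed.

Definition indic_L1fun (F : set T) (mF : measurable F) (Foo : (mu F < +oo)%E) :
  L1fun k mu := MkL1fun (indic_L1funP mF Foo).

(** The [e i] may live outside [E], so that the same family serves the measurable subsets of [E]. *)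
Definition finite_dimensional_on (E : set T) : Prop :=
  exists (n : nat) (e : 'I_n -> X),
    forall v, exists c : 'I_n -> K, restr E v = \sum_(i < n) c i *: e i.

Lemma finite_dimensional_onS (E F : set T) : measurable E -> measurable F ->
  E `<=` F -> finite_dimensional_on F -> finite_dimensional_on E.
Proof.
move=> mE mF EF [n [e he]]; exists n, e => v.
have [c hc] := he (restr E v); exists c; rewrite -hc restrI//.
by rewrite setIC (setIidl EF).
Qed.

Lemma finite_dimensional_onU (E F : set T) : measurable E -> measurable F ->
  finite_dimensional_on E -> finite_dimensional_on F ->
  finite_dimensional_on (E `|` F).
Proof.
move=> mE mF fE fF.
have [m [e' he']] : finite_dimensional_on (F `\` E).
  exact: finite_dimensional_onS (measurableD mF mE) mF (@subDsetl _ _ _) fF.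
move: fE => [n [e he]].
exists (n + m)%N, (fun i => match fintype.split i with inl j => e j | inr j => e' j end) => v.
have [c hc] := he v; have [c' hc'] := he' v.
exists (fun i => match fintype.split i with inl j => c j | inr j => c' j end).
have EF0 : E `&` (F `\` E) = set0 by rewrite setDE setICA setICr setI0.
have -> : E `|` F = E `|` (F `\` E) by rewrite setDE setUIr setUv setIT.
rewrite (restrU _ mE (measurableD mF mE) EF0).
rewrite big_split_ord /= hc hc'; congr (_ + _); apply: eq_bigr => i _.
  by rewrite (unsplitK (inl i)).
by rewrite (unsplitK (inr i)).
Qed.

(** On an atom the real and imaginary parts of an integrable function are constant almost
    everywhere, so the indicator alone spans. *)
Lemma finite_dimensional_on_atom (F : set T) : measurable F ->
  (0 < mu F)%E -> (mu F < +oo)%E ->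
  (forall G, measurable G -> G `<=` F -> mu G = 0%E \/ mu (F `\` G) = 0%E) ->
  finite_dimensional_on F.
Proof.
move=> mF F0 Foo atom; exists 1%N, (fun=> L1class (indic_L1fun mF Foo)) => v.
have [c1 n1] := atom_constant mF F0 Foo atom
  (integrableS measurableT mF (@subsetT _ _) (L1fun_integrable_sre (L1repr v))).
have [c2 n2] := atom_constant mF F0 Foo atom
  (integrableS measurableT mF (@subsetT _ _) (L1fun_integrable_sim (L1repr v))).
exists (fun=> smk k c1 c2); rewrite big_ord_recl big_ord0 addr0.
rewrite -L1class_scaler /Lmul; apply/L1classP.
apply: negligibleS (negligibleU n1 n2) => x /= h.
have [xF|xF] := pselect (F x); last first.
  exfalso; apply: h.
  change (indic_multiplier R k F x * L1repr v x = smk k c1 c2 * sofR k (\1_F x)).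
  by rewrite indic_multiplierE// indicE memNset// sofR0 mulr0 mul0r.
apply: contrapT => /not_orP[/not_andP[//|/= /negP/negPn/eqP e1]].
move=> /not_andP[//|/= /negP/negPn/eqP e2]; apply: h.
change (indic_multiplier R k F x * L1repr v x = smk k c1 c2 * sofR k (\1_F x)).
by rewrite indic_multiplierE// indicE mem_set// sofR1 mulr1 mul1r -e1 -e2 smk_eta.
Qed.

(** If every subset of [E] of finite measure were null, each integrable [v] would vanish almost
    everywhere on [E]: by Chebyshev's inequality the sets where [|v| >= 1 / (n + 1)] have finite
    measure. *)
Lemma finite_positive_subset (E : set T) : measurable E ->
  ~ finite_dimensional_on E ->
  exists F, [/\ measurable F, F `<=` E, (0 < mu F)%E & (mu F < +oo)%E].
Proof.
move=> mE nE; apply: contrapT => /forallNP noF; apply: nE.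
exists 0%N, (fun=> 0) => v; exists (fun=> 0); rewrite big_ord0.
pose p x := sre `|L1repr v x : K|.
have mp : measurable_fun setT p by apply: scalar_measurable_norm; exact: L1fun_meas.
pose F n := E `&` [set x | n.+1%:R^-1 <= p x].
have mF n : measurable (F n).
  apply: measurableI => //; rewrite -[X in measurable X]setTI.
  rewrite (_ : [set x | _] = p @^-1` `[n.+1%:R^-1, +oo[); first exact: mp.
  by apply/seteqP; split => x /=; rewrite in_itv /= andbT.
have F0 n : mu (F n) = 0%E.
  apply: contrapT => Fn; apply: (noF (F n)); split => //; first exact: subIsetl.
    by rewrite lt_neqAle measure_ge0 andbT eq_sym; apply/eqP.
  have : (n.+1%:R^-1%:E * mu (F n) < +oo)%E.
    rewrite -integral_cst//.
    apply: le_lt_trans (L1fun_int (L1repr v)).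
    rewrite integral_mkcond; apply: ge0_le_integral => //.
    - by move=> x _; apply: erestrict_ge0 => y _; rewrite lee_fin.
    - by apply/(measurable_restrictT _ (mF n)) => //.
    - exact/measurable_EFinP.
    - move=> x _; rewrite patchE; case: ifPn => [|_]; last by rewrite lee_fin sre_norm_ge0.
      by rewrite inE lee_fin => -[].
  case: (mu (F n)) (measure_ge0 mu (F n)) => [r _ _|_|//]; first exact: ltry.
  by rewrite gt0_muley// lte_fin.
rewrite /Lmul -(scale0r (L1class (L1repr v) : X)) -L1class_scaler; apply/L1classP.
apply: negligibleS (_ : mu.-negligible (\bigcup_n F n)); last first.
  apply: negligible_bigcup => n; exact: (proj2 (negligibleP mu (mF n)) (F0 n)).
move=> x /= h; apply: contrapT => nF; apply: h.
change (indic_multiplier R k E x * L1repr v x = 0 * L1repr v x).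
rewrite indic_multiplierE// mul0r; case: ifPn => [|_]; last by rewrite mul0r.
rewrite inE mul1r => Ex; apply/eqP; apply: contrapT => /negP v0; apply: nF.
have p0 : 0 < p x by rewrite -(sofR_lt k) sofR_norm sofR0 normr_gt0.
exists (Num.truncn (p x)^-1) => //; split => //=.
by rewrite -[leRHS]invrK lef_pV2 ?posrE ?invr_gt0// ltW// truncnS_gt.
Qed.

(** Otherwise removing any subset of finite positive measure leaves a finite dimensional remainder.
    One such [F] is then infinite dimensional, hence no atom, and splits into [G] and [F] minus [G],
    both of positive measure. The remainders of [E] after removing each of them are finite
    dimensional and cover [E], a contradiction. *)
Lemma finite_positive_split (E : set T) : measurable E ->
  ~ finite_dimensional_on E ->
  exists F, [/\ measurable F, F `<=` E, (0 < mu F)%E, (mu F < +oo)%E &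
    ~ finite_dimensional_on (E `\` F)].
Proof.
move=> mE nE; apply: contrapT => /forallNP noF.
have small G : measurable G -> G `<=` E -> (0 < mu G)%E -> (mu G < +oo)%E ->
    finite_dimensional_on (E `\` G).
  by move=> mG GE G0 Goo; apply: contrapT => h; apply: (noF G).
have [F [mF FE F0 Foo]] := finite_positive_subset mE nE.
have nF : ~ finite_dimensional_on F.
  move=> fF; apply: nE; rewrite -(setDUK FE).
  by apply: finite_dimensional_onU => //; [exact: measurableD|exact: small].
apply: nF; apply: finite_dimensional_on_atom => // G mG GF.
have mFG := measurableD mF mG.
apply: contrapT => /not_orP[/eqP G0 /eqP FG0].
have pos A : mu A != 0%E -> (0 < mu A)%E by rewrite lt_neqAle measure_ge0 andbT eq_sym.
have fin A : measurable A -> A `<=` F -> (mu A < +oo)%E.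
  by move=> mA AF; apply: le_lt_trans Foo; apply: le_measure; rewrite ?inE.
have FGF : F `\` G `<=` F by exact: subDsetl.
have f1 := small _ mG (subset_trans GF FE) (pos _ G0) (fin _ mG GF).
have f2 := small _ mFG (subset_trans FGF FE) (pos _ FG0) (fin _ mFG FGF).
apply: nE; apply: (@finite_dimensional_onS _ ((E `\` G) `|` (E `\` (F `\` G)))) => //.
- by apply: measurableU; exact: measurableD.
- move=> x Ex; have [Gx|nGx] := pselect (G x); last by left.
  by right; split => // -[].
- by apply: finite_dimensional_onU => //; exact: measurableD.
Qed.

Lemma infinite_dimensional_disjoint : infinite_dimensional X ->
  forall N, exists F : nat -> set T,
    [/\ forall i, measurable (F i), trivIset setT F,
        forall i, (mu (F i) < +oo)%E & forall i, (i < N)%N -> (0 < mu (F i))%E].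
Proof.
move=> infX N.
(* The induction also carries a set [E] that avoids all the [F i] and is still infinite dimensional;
   the next set is cut out of [E]. *)
suff : exists F : nat -> set T,
    [/\ forall i, measurable (F i), trivIset setT F,
        forall i, (mu (F i) < +oo)%E, forall i, (i < N)%N -> (0 < mu (F i))%E &
        exists E, [/\ measurable E, forall i, F i `&` E = set0 & ~ finite_dimensional_on E]].
  by move=> [F [? ? ? ? _]]; exists F.
elim: N => [|N [F [mF tF Foo F0 [E [mE FE nE]]]]].
  exists (fun=> set0); split => //.
  - by apply/trivIsetP => *; rewrite setI0.
  - by move=> i; rewrite measure0.
  exists setT; split => // [i|[n [e he]]]; first by rewrite set0I.
  by apply: infX; exists n, e => v; have [c] := he v; rewrite restrT; exists c.
have [G [mG GE G0 Goo nEG]] := finite_positive_split mE nE.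
have FG i : F i `&` G = set0.
  by rewrite -subset0 -(FE i); apply: setIS.
exists (fun i => if (i < N)%N then F i else if i == N then G else set0); split.
- by move=> i; case: ifP => // _; case: ifP.
- apply/trivIsetP => i j _ _ ij.
  have [iN|iN] := boolP (i < N)%N; have [jN|jN] := boolP (j < N)%N.
  + by move/trivIsetP : tF; apply.
  + by case: ifP => // _; rewrite setI0.
  + by case: ifP => // _; rewrite ?set0I// setIC.
  + have [iE|_] := eqVneq i N; last by rewrite set0I.
    have [jE|_] := eqVneq j N; last by rewrite setI0.
    by move: ij; rewrite iE jE eqxx.
- by move=> i; case: ifP => // _; case: ifP => // _; rewrite measure0.
- move=> i; rewrite ltnS leq_eqVlt => /orP[/eqP->|iN]; first by rewrite ltnn eqxx.
  by rewrite iN; exact: F0.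
- exists (E `\` G); split => //; first exact: measurableD.
  move=> i; case: ifP => _; last case: ifP => _; rewrite ?set0I//.
    by rewrite -subset0 -(FE i); apply: setIS; exact: subDsetl.
  by rewrite setDE setICA setICr setI0.
Qed.

End disjoint_sets.

(** * Finite rank step operators *)

Section finite_rank_operator.
Context (R : realType) (k : scalar_kind) d (T : measurableType d)
  (mu : {measure set T -> \bar R}).
Local Notation K := (scalars R k).
Local Notation X := (L1 k mu).
Context (Y : normedModType K).
Implicit Types (w : multiplier R k T) (F : nat -> set T) (z : nat -> Y)
  (P : pred nat) (N : nat).

(** One family of operators serves both implications: [w] is trivial in the first and the phase of
    [f] in the second, where [P] selects the pieces on which the operator is changed. *)
Definition step_op w F z P N (h : X) : Y :=
  \sum_(j < N | P j) L1int (Lmul w (restr (F j) h)) *: z j.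

Lemma step_op_linear w F z P N : linear (step_op w F z P N).
Proof.
move=> a u v; rewrite /step_op scaler_sumr -big_split /=.
by apply: eq_bigr => j _; rewrite !linearP scalerDl scalerA.
Qed.

HB.instance Definition _ w F z P N := @GRing.isLinear.Build K X Y _
  (step_op w F z P N) (step_op_linear w F z P N).

Lemma norm_L1int_Lmul w (h : X) : sre `|L1int (Lmul w h)| <= rnorm h.
Proof. exact: le_trans (norm_L1int _) (rnorm_Lmul _ _). Qed.

Lemma rnorm_step_op w F z P N h : (forall j, measurable (F j)) ->
  trivIset setT F -> (forall j : 'I_N, P j -> rnorm (z j) <= 1) ->
  rnorm (step_op w F z P N h) <=
    rnorm (restr (\big[setU/set0]_(j < N | P j) F j) h).
Proof.
move=> mF tF z1; rewrite rnorm_restr_bigsetU//.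
rewrite (le_trans (rnorm_sum _ _ _))//; apply: ler_sum => j Pj; rewrite rnormZ.
apply: le_trans (norm_L1int_Lmul w _).
by rewrite ler_piMr ?sre_norm_ge0// z1.
Qed.

Lemma step_op_restr w F z P N h (i : 'I_N) : (forall j, measurable (F j)) ->
  trivIset setT F -> P i ->
  step_op w F z P N (restr (F i) h) = L1int (Lmul w (restr (F i) h)) *: z i.
Proof.
move=> mF tF Pi; rewrite /step_op (bigD1 i)//= restrI// setIid big1 ?addr0//.
move=> j /andP[_ ji]; rewrite restrI//.
have /trivIsetP/(_ j i I I) -> := tF; last by [].
by rewrite restr0 !linear0 scale0r.
Qed.

End finite_rank_operator.

(** * Series of nonnegative reals *)

Section sums.
Context (R : realType).

Lemma nneseries_cvg (P : pred nat) (a : nat -> R) (l : R) : (forall j, 0 <= a j) ->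
  (\sum_(0 <= j <oo | P j) (a j)%:E)%E = l%:E ->
  \sum_(j < n | P j) a j @[n --> \oo] --> l.
Proof.
move=> a0 al; apply: (@fine_cvg _ _ _ _ (fun n => (\sum_(j < n | P j) a j)%:E)).
rewrite -al; have h : cvgn (fun n => (\sum_(0 <= j < n | P j) (a j)%:E)%E).
  by apply: is_cvg_nneseries => n _ _; rewrite lee_fin.
apply: cvg_trans h; apply: near_eq_cvg; near=> n.
by rewrite big_mkord sumEFin.
Unshelve. all: by end_near. Qed.

Lemma sum_le_nneseries (P : pred nat) (a : nat -> R) n : (forall j, 0 <= a j) ->
  ((\sum_(j < n | P j) a j)%:E <= \sum_(0 <= j <oo | P j) (a j)%:E)%E.
Proof.
move=> a0; rewrite -sumEFin -(big_mkord P (fun j => (a j)%:E)).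
by apply: nneseries_lim_ge => i _ _; rewrite lee_fin.
Qed.

Lemma lt_nneseries (P : pred nat) (a : nat -> R) (x : R) : (forall j, 0 <= a j) ->
  (x%:E < \sum_(0 <= j <oo | P j) (a j)%:E)%E -> exists n, x < \sum_(j < n | P j) a j.
Proof.
move=> a0; apply: contraPP => /forallNP h; apply/negP; rewrite -leNgt.
apply: lime_le; first by apply: is_cvg_nneseries => n _ _; rewrite lee_fin.
near=> n; rewrite big_mkord sumEFin lee_fin leNgt; exact/negP.
Unshelve. all: by end_near. Qed.

End sums.

(** * From the BPBZp to the AHSp *)

Section first_part.
Context (R : realType) (k : scalar_kind) d (T : measurableType d)
  (mu : {measure set T -> \bar R}).
Local Notation K := (scalars R k).
Local Notation X := (L1 k mu).

Definition normalized_indic (F : set T) (mF : measurable F)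
    (Foo : (mu F < +oo)%E) : X :=
  sofR k (fine (mu F))^-1 *: L1class (indic_L1fun k mF Foo).

Section normalized_indic.
Context (F : nat -> set T) (mF : forall i, measurable (F i))
  (tF : trivIset setT F) (Foo : forall i, (mu (F i) < +oo)%E).
Local Notation e i := (normalized_indic (mF i) (Foo i)).

Lemma rnorm_normalized_indic i : (0 < mu (F i))%E -> rnorm (e i) = 1.
Proof.
move=> F0; have c0 : 0 < fine (mu (F i)) by rewrite fine_gt0// F0 Foo.
rewrite rnormZR rnorm_L1class ger0_norm ?invr_ge0 ?(ltW c0)//.
rewrite (_ : Rintegral _ _ _ = fine (mu (F i))) ?mulVf ?gt_eqF//.
rewrite /Rintegral -[in RHS](setIT (F i)) -integral_indic//.
congr fine; apply: eq_integral => x _ /=.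
by rewrite norm_sofR sre_sofR indicE ger0_norm ?ler0n.
Qed.

Lemma L1int_normalized_indic i : (0 < mu (F i))%E -> L1int (e i) = 1.
Proof.
move=> /rnorm_normalized_indic e1; rewrite linearZ_LR /=.
have F0 : forall x, 0 <= \1_(F i) x :> R by move=> x; rewrite indicE ler0n.
rewrite (L1int_sofR F0) // -[_ *: _]sofRM -sofR1; congr sofR.
by rewrite -e1 rnormZR ger0_norm// invr_ge0 fine_ge0.
Qed.

Lemma restr_normalized_indic i j : restr (F i) (e j) = if i == j then e j else 0.
Proof.
rewrite linearZ_LR /= Lmul_class.
have [->|ij] := eqVneq i j.
  congr (_ *: _); apply: L1class_eq => x.
  change (indic_multiplier R k (F j) x * sofR k (\1_(F j) x) = sofR k (\1_(F j) x)).
  rewrite indic_multiplierE// indicE; case: ifP => // _; first by rewrite sofR1 mulr1.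
  by rewrite mul0r sofR0.
rewrite -[RHS](scaler0 _ (sofR k (fine (mu (F j)))^-1)); congr (_ *: _).
rewrite -[RHS](scale0r (L1class (indic_L1fun k (mF j) (Foo j)) : X)).
rewrite -L1class_scaler; apply: L1class_eq => x.
change (indic_multiplier R k (F i) x * sofR k (\1_(F j) x) = 0 * sofR k (\1_(F j) x)).
rewrite indic_multiplierE// indicE mul0r.
have /trivIsetP/(_ i j I I ij) Fij := tF.
have : ~~ ((x \in F i) && (x \in F j)) by rewrite -in_setI Fij in_set0.
by case: (_ \in F i); case: (_ \in F j); rewrite ?sofR0 ?mul0r ?mulr0.
Qed.

Lemma restr_sum_normalized_indic (b : nat -> R) N i : (i < N)%N ->
  restr (F i) (\sum_(j < N) sofR k (b j) *: e j) = sofR k (b i) *: e i.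
Proof.
move=> iN; rewrite linear_sum (bigD1 (Ordinal iN))//= linearZ_LR /=.
rewrite restr_normalized_indic eqxx big1 ?addr0// => j.
rewrite -val_eqE /= => ji.
by rewrite linearZ_LR /= restr_normalized_indic eq_sym (negbTE ji) scaler0.
Qed.

Lemma rnorm_sum_normalized_indic (b : nat -> R) N : (forall j, 0 <= b j) ->
  (forall j, (j < N)%N -> (0 < mu (F j))%E) ->
  rnorm (\sum_(j < N) sofR k (b j) *: e j) = \sum_(j < N) b j.
Proof.
move=> b0 F0; have bE (j : 'I_N) : rnorm (sofR k (b j) *: e j) = b j.
  by rewrite rnormZR rnorm_normalized_indic ?mulr1 ?ger0_norm ?F0.
apply/eqP; rewrite eq_le; apply/andP; split.
  by rewrite (le_trans (rnorm_sum _ _ _))// (eq_bigr _ (fun j _ => bE j)).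
set x0 := \sum_(j < N) _ *: _.
have := rnorm_Lmul (indic_multiplier R k (\big[setU/set0]_(j < N) F j)) x0.
apply: le_trans; rewrite (rnorm_restr_bigsetU xpredT N x0 mF tF).
by apply: ler_sum => j _; rewrite restr_sum_normalized_indic// bE.
Qed.

End normalized_indic.

(* [Re phi] is at most the norm on the restrictions to [E] and to its complement,
   while the two sums over the pieces are equal. *)
Lemma norming_restr (phi : {linear X -> K^o}) (u : X) (E : set T) :
  (forall h, sre `|phi h| <= rnorm h) -> phi u = sofR k (rnorm u) -> measurable E ->
  phi (restr E u) = sofR k (rnorm (restr E u)).
Proof.
move=> phi1 phiu mE; apply: sre_norm_eq => //.
have phiE : phi (restr E u) + phi (restr (~` E) u) = phi u.
  by rewrite -linearD restrC// subrKC.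
have h : sre (phi (restr E u)) + sre (phi (restr (~` E) u)) = rnorm u.
  by rewrite -sreD phiE phiu sre_sofR.
have h1 := le_trans (ler_norm _) (le_trans (sre_le_norm _) (phi1 (restr E u))).
have h2 := le_trans (ler_norm _) (le_trans (sre_le_norm _) (phi1 (restr (~` E) u))).
have h3 := rnorm_restrC u mE.
by apply/eqP; rewrite eq_le h1 /=; move: h h2 h3; lra.
Qed.

End first_part.

Section first_part_main.
Context (R : realType) (k : scalar_kind) d (T : measurableType d)
  (mu : {measure set T -> \bar R}).
Local Notation K := (scalars R k).
Local Notation X := (L1 k mu).

Definition scale_form (Y : normedModType K) (c : K) (f : {linear Y -> K^o}) (y : Y) : K^o :=
  c * f y.

Lemma scale_form_linear (Y : normedModType K) c (f : {linear Y -> K^o}) :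
  linear (scale_form c f : Y -> K^o).
Proof.
move=> a u v; rewrite /scale_form linearP.
change (c * (a * f u + f v) = a * (c * f u) + c * f v).
by rewrite mulrDr mulrCA.
Qed.

HB.instance Definition _ (Y : normedModType K) c (f : {linear Y -> K^o}) :=
  @GRing.isLinear.Build K Y K^o _ (scale_form c f) (scale_form_linear c f).

Lemma BPBZp_YstarAHSp (Y : completeNormedModType K) :
  infinite_dimensional X -> BPBZp X Y -> YstarAHSp Y.
Proof.
move=> infX bpb eps eps0.
(* [g] is the relative error allowed on a good piece, and [e1 = g * (ep / 2)] is the total error, so
   that by Markov's inequality the bad pieces have mass below [ep / 2]. As [e1 <= ep / 8], the final
   errors [6 * e1] and [2 * e1 + 2 * g] stay below [ep]. *)
pose ep := Num.min eps 1; pose e1 := ep ^+ 2 / 8; pose g := ep / 4.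
have ep0 : 0 < ep by rewrite lt_min eps0 ltr01.
have ep1 : ep <= 1 by rewrite ge_min lexx orbT.
have epe : ep <= eps by rewrite ge_min lexx.
have e10 : 0 < e1 by rewrite divr_gt0// exprn_gt0.
have g0 : 0 < g by rewrite divr_gt0.
have e1le : e1 <= ep / 8 by rewrite ler_pM2r ?invr_gt0// expr2 ler_piMr// ltW.
have e1g : e1 = g * (ep / 2) by rewrite /e1 /g expr2; field.
have [eta1 [eta10 bpb1]] := bpb _ e10.
(* The square is what [norm_1sub_sqr] needs to bring [ystar (T0 x0)] within [e1] of 1. *)
pose eta := Num.min eta1 (e1 ^+ 2 / 2); exists eta.
have eta0 : 0 < eta by rewrite lt_min eta10 divr_gt0// exprn_gt0.
have etale : eta <= e1 ^+ 2 / 2 by rewrite ge_min lexx orbT.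
have eta1le : eta <= eta1 by rewrite ge_min lexx.
have etae : eta <= e1.
  apply: le_trans etale _; rewrite expr2 -mulrA ler_piMr ?(ltW e10)//.
  by move: e1le ep1; lra.
split => // y ystar a y1 ystar1 a0 suma hRe.
have [ystarb ystarn] := ystar1; have ystar_le := dual_sphere_le ystar1.
have suma' : (\sum_(0 <= j <oo) (a j)%:E)%E = 1%:E.
  by rewrite -suma; apply: eq_eseriesr => j _; rewrite ger0_norm.
have acvg : series a @ \oo --> (1 : R).
  have := nneseries_cvg a0 suma'; apply: cvg_trans; apply: near_eq_cvg.
  by apply: nearW => n; rewrite /series /= big_mkord.
have s1 n : \sum_(j < n) a j <= 1.
  by rewrite -lee_fin -suma'; exact: sum_le_nneseries.
have ycvg : cvgn (series (fun j => sofR k (a j) *: y j)).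
  apply: (@series_cvg _ _ _ _ a); last by apply/cvg_ex; exists 1.
  by move=> n; rewrite rnormZR ger0_norm// ler_piMr//; exact: y1.
have [N hN] : exists N, sre (ystar (\sum_(j < N) sofR k (a j) *: y j)) > 1 - eta.
  have /sre_cvg := bounded_cvg ystarb ycvg.
  move=> /cvgrPdist_lt/(_ (sre (ystar (limn (series (fun j => sofR k (a j) *: y j)))) - (1 - eta))).
  rewrite subr_gt0 => /(_ hRe)[N _ /(_ N (leqnn N)) H]; exists N.
  move: H; rewrite /series /= big_mkord ltr_norml => /andP[_]; lra.
pose s := \sum_(j < N) a j.
have s_gt : 1 - eta < s.
  apply: (lt_le_trans hN); apply: le_trans (ler_norm _) _.
  apply: le_trans (sre_le_norm _) _; apply: le_trans (ystar_le _) _.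
  rewrite (le_trans (rnorm_sum _ _ _))//; apply: ler_sum => j _.
  by rewrite rnormZR ger0_norm// ler_piMr//; exact: y1.
have etalt : eta < 1 by move: etae e1le ep1; lra.
have s0 : 0 < s by apply: le_lt_trans s_gt; move: etalt; lra.
have [F [mF tF Foo F0]] := infinite_dimensional_disjoint infX N.
pose b j := a j / s.
have b0 j : 0 <= b j by rewrite divr_ge0// ltW.
have sumb : \sum_(j < N) b j = 1 by rewrite -mulr_suml mulfV ?gt_eqF.
pose e j := normalized_indic k (mF j) (Foo j).
pose x0 := \sum_(j < N) sofR k (b j) *: e j.
have x01 : rnorm x0 = 1 by rewrite rnorm_sum_normalized_indic.
have x0F j : (j < N)%N -> restr (F j) x0 = sofR k (b j) *: e j.
  by move=> jN; rewrite restr_sum_normalized_indic.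
have e_norm j : (j < N)%N -> rnorm (e j) = 1.
  by move=> jN; rewrite rnorm_normalized_indic ?F0.
pose T0 : {linear X -> Y} := step_op (indic_multiplier R k setT) F y xpredT N.
have T0e j : (j < N)%N -> T0 (e j) = y j.
  move=> jN; have := @step_op_restr _ _ _ _ _ _ (indic_multiplier R k setT) F y xpredT N
    (e j) (Ordinal jN) mF tF isT.
  rewrite restr_normalized_indic //= eqxx restrT L1int_normalized_indic ?F0//.
  by rewrite scale1r.
have T0_le h : rnorm (T0 h) <= rnorm h.
  have := @rnorm_step_op _ _ _ _ _ _ (indic_multiplier R k setT) F y xpredT N h mF tF (fun j _ => y1 j).
  by move=> /le_trans; apply; exact: rnorm_Lmul.
have T0b : bounded_operators X Y T0.
  by apply: (@bounded_continuous _ _ _ _ _ 1) => h; rewrite mul1r.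
have T0x0 : T0 x0 = sofR k s^-1 *: \sum_(j < N) sofR k (a j) *: y j.
  rewrite linear_sum scaler_sumr; apply: eq_bigr => j _.
  by rewrite linearZ_LR /= -/T0 T0e// scalerA -sofRM mulrC.
(* Passing from [a] to [b] divides by [s <= 1], which can only increase a positive real part. *)
have reT0x0 : 1 - eta < sre (ystar (T0 x0)).
  rewrite T0x0 linearZ_LR /= sreM sre_sofR sim_sofR mul0r subr0.
  apply: (lt_le_trans hN); rewrite ler_peMl//; last by rewrite invf_ge1 // /s s1.
  by apply: le_trans (ltW hN); move: etalt; lra.
(* The norm of [T0] may be less than 1, but its value at [x0] forces [t > 1 - eta]. Dividing by [t]
   moves the operator by at most [1 - t] in norm, hence by less than [e1]. *)
pose t := opnorm T0.
have t1 : t <= 1 by apply: opnorm_le => // h; rewrite mul1r.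
have t_gt : 1 - eta < t.
  apply: (lt_le_trans reT0x0); apply: le_trans (ler_norm _) _.
  apply: le_trans (sre_le_norm _) _; apply: le_trans (ystar_le _) _.
  by have := opnormP T0b x0; rewrite x01 mulr1.
have t0 : 0 < t by apply: le_lt_trans t_gt; move: etalt; lra.
pose T1 : {linear X -> Y} := step_op (indic_multiplier R k setT) F
  (fun j => sofR k t^-1 *: y j) xpredT N.
have T1E h : T1 h = sofR k t^-1 *: T0 h.
  rewrite /T1 /T0 /= /step_op scaler_sumr; apply: eq_bigr => j _.
  by rewrite !scalerA mulrC.
have T1_le h : rnorm (T1 h) <= rnorm h.
  rewrite T1E rnormZR ger0_norm ?invr_ge0 ?(ltW t0)// mulrC ler_pdivrMr// mulrC.
  exact: opnormP.
have T1b : bounded_operators X Y T1.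
  by apply: (@bounded_continuous _ _ _ _ _ 1) => h; rewrite mul1r.
have T1n : opnorm T1 = 1.
  apply/eqP; rewrite eq_le; apply/andP; split.
    by apply: opnorm_le => // h; rewrite mul1r.
  rewrite -(ler_pM2l t0) mulr1; apply: opnorm_le.
    rewrite mulr_ge0 ?(ltW t0)//; have := opnormP T1b x0; rewrite x01 mulr1.
    by apply: le_trans; exact: rnorm_ge0.
  move=> h; rewrite -mulrA -ler_pdivrMl//; apply: le_trans (opnormP T1b h).
  by rewrite T1E rnormZR ger0_norm ?invr_ge0 ?(ltW t0).
have T10 h : rnorm (T1 h - T0 h) <= e1 * rnorm h.
  rewrite T1E -[X in _ - X]scale1r -scalerBl -sofR1 -sofRB rnormZR ger0_norm; last first.
    by rewrite subr_ge0 invf_ge1.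
  apply: (@le_trans _ _ ((t^-1 - 1) * (t * rnorm h))).
    by rewrite ler_wpM2l ?subr_ge0 ?invf_ge1// opnormP.
  rewrite mulrA mulrBl mulVf ?gt_eqF// mul1r ler_wpM2r ?rnorm_ge0//.
  by move: t_gt etae; lra.
have hT1 : 1 - eta1 < rnorm (ystar (T1 x0)).
  apply: (@le_lt_trans _ _ (1 - eta)); first by rewrite lerB.
  apply: (lt_le_trans reT0x0); apply: (le_trans _ (sre_le_norm _)).
  apply: (le_trans _ (ler_norm _)).
  rewrite T1E linearZ_LR /= sreM sre_sofR sim_sofR mul0r subr0.
  rewrite ler_peMl ?invf_ge1//.
  by apply: le_trans (ltW reT0x0); move: etalt; lra.
have [ys1 [x1 [S [[ys1n x1n Sb] [Sn ys1S x10 ys10 ST]]]]] :=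
  bpb1 T1 ystar x0 T1b T1n ystar1 x01 hT1.
have [ys1b _] := ys1n; have ys1_le := dual_sphere_le ys1n.
have S_le h : rnorm (S h) <= rnorm h by have := opnormP Sb h; rewrite Sn mul1r.
have ST_le h : rnorm (S h - T1 h) <= e1 * rnorm h.
  by rewrite (le_trans (opnorm_distP Sb T1b h))// ler_wpM2r ?rnorm_ge0// ltW.
have ys_le v : rnorm (ys1 v - ystar v) <= e1 * rnorm v.
  by rewrite (le_trans (opnorm_distP ys1b ystarb v))// ler_wpM2r ?rnorm_ge0// ltW.
have Sx1 : rnorm (S x1) = 1.
  have h1 := S_le x1; rewrite x1n in h1; have h2 := ys1_le (S x1).
  by apply/eqP; rewrite eq_le h1 -ys1S.
pose c : K := ys1 (S x1).
have c0 : c != 0.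
  by apply/eqP => c0; move: ys1S; rewrite -/c c0 rnorm0 => /esym/eqP; rewrite oner_eq0.
have c1 : sre `|c| = 1 by [].
have cV1 : sre `|c^-1| = 1.
  by rewrite normfV -[`|c|]sofR_norm c1 sofR1 invr1 -sofR1 sre_sofR.
(* A path from [c] to 1 through [ystar (S x1)], [ystar (T1 x1)], [ystar (T1 x0)] and
   [ystar (T0 x0)]: five steps of length at most [e1]. *)
have dist1c : sre `|1 - c| <= 5 * e1.
  have h1 : rnorm (c - ystar (S x1)) <= e1.
    by have := ys_le (S x1); rewrite Sx1 mulr1.
  have h2 : sre `|ystar (S x1 - T1 x1)| <= e1.
    by apply: le_trans (ystar_le _) _; have := ST_le x1; rewrite x1n mulr1.
  have h3 : sre `|ystar (T1 x1 - T1 x0)| <= e1.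
    rewrite -linearB; apply: le_trans (ystar_le _) _; apply: le_trans (T1_le _) _.
    exact: ltW.
  have h4 : sre `|ystar (T1 x0 - T0 x0)| <= e1.
    by apply: le_trans (ystar_le _) _; have := T10 x0; rewrite x01 mulr1.
  have h5 : rnorm (1 - ystar (T0 x0) : K^o) <= e1.
    rewrite -ler_sqr ?nnegrE ?rnorm_ge0 ?(ltW e10)//.
    have := @norm_1sub_sqr _ _ (ystar (T0 x0)).
    have -> : sre `|ystar (T0 x0)| <= 1.
      by rewrite (le_trans (ystar_le _))// (le_trans (T0_le _))// x01.
    move=> /(_ isT) h6; apply: le_trans h6 _.
    by clear -reT0x0 etale; move: (sre _) reT0x0 etale => q; lra.
  rewrite -[sre _]/(rnorm (1 - c : K^o)) rdistC.
  have -> : c - 1 = (c - ystar (S x1)) + (ystar (S x1 - T1 x1)) +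
     ystar (T1 x1 - T1 x0) + ystar (T1 x0 - T0 x0) + (ystar (T0 x0) - 1) :> K^o.
    by rewrite !linearB !subrKA.
  have h5' : rnorm (ystar (T0 x0) - 1 : K^o) <= e1 by rewrite rdistC.
  rewrite (_ : 5 * e1 = e1 + e1 + e1 + e1 + e1); last by ring.
  by do 4 (apply: (le_trans (rnormD _ _)); apply: lerD => //).
pose zstar : {linear Y -> K^o} := scale_form c^-1 ys1.
have zstarE v : zstar v = c^-1 * ys1 v by [].
have zstar_le v : rnorm (zstar v) <= rnorm v.
  by rewrite /rnorm zstarE normrM sre_normM cV1 mul1r; exact: ys1_le.
have zstarSx1 : zstar (S x1) = 1 by rewrite zstarE mulVf.
have zstarn : dual_sphere Y zstar.
  split; first by apply: (@bounded_continuous _ _ _ _ _ 1) => v; rewrite mul1r.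
  apply: (opnorm_eq1 zstar_le Sx1).
  by rewrite zstarSx1 /rnorm normr1 -sofR1 sre_sofR.
have distz v : rnorm (zstar v - ystar v) <= 6 * e1 * rnorm v.
  have -> : zstar v - ystar v = (c^-1 - 1) * ys1 v + (ys1 v - ystar v) :> K^o.
    by rewrite zstarE mulrBl mul1r subrKA.
  rewrite (le_trans (rnormD _ _))// (_ : 6 * e1 = 5 * e1 + e1); last by ring.
  rewrite [leRHS]mulrDl lerD// /rnorm normrM sre_normM ler_pM ?sre_norm_ge0//.
    rewrite -[c^-1 - 1]mul1r -{1}(mulVf c0) -mulrA mulrBr mulfV// mulr1.
    by rewrite normrM sre_normM cV1 mul1r.
pose r j := restr (F j) x1.
(* The strict inequality excludes the indices with [b j = 0], so [z] never divides by 0 on [A]. *)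
pose A := [set j | (j < N)%N /\ rnorm (r j - sofR k (b j) *: e j) < g * b j].
pose z j := sofR k (rnorm (r j))^-1 *: S (r j).
have be_norm j : (j < N)%N -> rnorm (sofR k (b j) *: e j) = b j.
  by move=> jN; rewrite rnormZR e_norm// mulr1 ger0_norm.
have bA j : A j -> 0 < b j.
  move=> [_ h]; have := le_lt_trans (rnorm_ge0 _) h.
  by rewrite pmulr_rgt0.
have rA j : A j -> `|rnorm (r j) - b j| < g * b j.
  move=> [jN h]; apply: le_lt_trans h.
  by rewrite -{1}(be_norm j jN) rnorm_dist.
have r0 j : A j -> 0 < rnorm (r j).
  move=> Aj; have := rA j Aj; have := bA j Aj; rewrite ltr_norml => bj /andP[h _].
  have gbj : g * b j <= b j by rewrite ler_piMl ?(ltW bj)//; clear -ep1; rewrite /g; lra.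
  by clear -h gbj; move: (rnorm _) (g * b j) (b j) h gbj => p q x; lra.
have zstarr j : zstar (S (r j)) = sofR k (rnorm (r j)).
  pose phi : {linear X -> K^o} := zstar \o S.
  apply: (@norming_restr _ _ _ _ _ phi) => //.
    by move=> h; apply: le_trans (zstar_le _) (S_le _).
  by rewrite x1n sofR1.
have zstarz j : A j -> zstar (z j) = 1.
  move=> Aj; rewrite /z linearZ_LR /= zstarr -[_ *: _]sofRM mulVf ?sofR1//.
  by rewrite gt_eqF// r0.
have zn j : A j -> rnorm (z j) = 1.
  move=> Aj; apply/eqP; rewrite eq_le; apply/andP; split.
    rewrite rnormZR ger0_norm ?invr_ge0 ?rnorm_ge0// mulrC ler_pdivrMr ?r0//.
    by rewrite mul1r S_le.
  apply: le_trans (zstar_le _); rewrite zstarz// /rnorm normr1 -sofR1 sre_sofR//.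
have zy j : A j -> rnorm (z j - y j) < eps.
  move=> Aj; have [jN rj] := Aj.
  pose u := sofR k (rnorm (r j))^-1 *: r j.
  have u1 : rnorm u = 1.
    by rewrite rnormZR ger0_norm ?invr_ge0 ?rnorm_ge0// mulVf// gt_eqF// r0.
  have zE : z j = S u by rewrite linearZ_LR.
  have ue : rnorm (u - e j) < 2 * g.
    (* After multiplication by [b j] the path goes through [r j]: rescaling [r j] to norm [b j]
       costs at most the difference of the norms, which is again below [g * b j]. *)
    rewrite -(ltr_pM2l (bA j Aj)) -[X in X * _]ger0_norm// -rnormZR scalerBr.
    rewrite (_ : _ - _ = (sofR k (b j) *: u - r j) + (r j - sofR k (b j) *: e j)); last first.
      by rewrite subrKA.
    apply: (le_lt_trans (rnormD _ _)).
    have -> : sofR k (b j) *: u - r j = sofR k (b j - rnorm (r j)) *: u.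
      rewrite sofRB scalerBl; congr (_ - _); rewrite scalerA -sofRM mulfV ?sofR1 ?scale1r//.
      by rewrite gt_eqF// r0.
    rewrite rnormZR u1 mulr1 distrC; have := rA j Aj; move: rj.
    rewrite (_ : b j * (2 * g) = g * b j + g * b j); last by clear; ring.
    by move=> h1 h2; exact: ltrD.
  rewrite zE -(T0e j jN).
  have -> : S u - T0 (e j) = (S u - T1 u) + (T1 u - T0 u) + T0 (u - e j).
    by rewrite linearB !subrKA.
  apply: (le_lt_trans (rnormD _ _)).
  apply: (@lt_le_trans _ _ (e1 + e1 + 2 * g)); last first.
    by apply: le_trans _ epe; clear -e1le ep1 ep0; rewrite /g; move: e1le; lra.
  apply: ler_ltD; last exact: le_lt_trans (T0_le _) ue.
  apply: (le_trans (rnormD _ _)); apply: lerD.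
    by have := ST_le u; rewrite u1 mulr1.
  by have := T10 u; rewrite u1 mulr1.
exists A, z, zstar; split; first by split.
split=> //; last first.
  apply: (@le_lt_trans _ _ (6 * e1)); first by apply: opnorm_le => //; rewrite mulr_ge0 ?(ltW e10).
  by apply: lt_le_trans epe; clear -e1le ep0; move: e1le ep0; lra.
have -> : A = [set j | j \in A] by apply/seteqP; split => j /=; rewrite inE.
rewrite -(@nneseries_esum _ (fun j => (a j)%:E) (fun j => j \in A)); last first.
  by move=> j _; rewrite lee_fin.
apply: lt_le_trans (sum_le_nneseries (fun j => j \in A) N a0); rewrite lte_fin.
have bsplit : \sum_(j < N | (j : nat) \in A) b j + \sum_(j < N | (j : nat) \notin A) b j = 1.
  by rewrite -sumb [RHS](bigID (fun j : 'I_N => (j : nat) \in A)).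
have bnA : \sum_(j < N | (j : nat) \notin A) b j < ep / 2.
  (* Markov's inequality: outside [A], each [g * b j] is at most the norm of [x1 - x0] on [F j], and
     these norms add up to less than [e1]. *)
  rewrite -(ltr_pM2l g0) -e1g; apply: le_lt_trans x10; rewrite mulr_sumr.
  apply: (@le_trans _ _ (\sum_(j < N) rnorm (restr (F j) (x1 - x0)))).
    rewrite [leRHS](bigID (fun j : 'I_N => (j : nat) \in A)) /=.
    rewrite ler_wpDl ?sumr_ge0//; first by move=> j _; exact: rnorm_ge0.
    apply: ler_sum => j jA; rewrite linearB /= x0F//.
    rewrite leNgt; apply/negP => h; move/negP : jA; apply.
    by rewrite inE; split.
  rewrite -(rnorm_restr_bigsetU xpredT N (x1 - x0) mF tF).
  exact: rnorm_Lmul.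
have aE : \sum_(j < N | (j : nat) \in A) a j = s * \sum_(j < N | (j : nat) \in A) b j.
  by rewrite mulr_sumr; apply: eq_bigr => j _; rewrite mulrC divfK// gt_eqF.
rewrite aE (_ : \sum_(j < N | _) b j = 1 - \sum_(j < N | (j : nat) \notin A) b j); last first.
  by rewrite -bsplit addrK.
move: (\sum_(j < N | _) b j) bnA => q qe.
have : (1 - eta) * (1 - ep / 2) < s * (1 - q).
  apply: ltr_pM; [by rewrite subr_ge0 ltW|by clear -ep1; lra|exact: s_gt|by rewrite ltrD2l ltrN2].
apply: le_lt_trans; have : 0 <= eta * ep by rewrite mulr_ge0// ltW.
by clear -epe etae e1le ep0; clearbody eta e1 ep; nra.
Qed.

End first_part_main.

(** * Bochner integrals and the Radon-Nikodym property *)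

(* The integral of a nonnegative function is a supremum over simple functions
   below it, hence it is monotone even on nonmeasurable functions. *)
Lemma integral_monotone (R : realType) d (T : measurableType d)
    (mu : {measure set T -> \bar R}) (f g : T -> \bar R) :
  (forall x, 0 <= f x)%E -> (forall x, f x <= g x)%E ->
  (\int[mu]_x f x <= \int[mu]_x g x)%E.
Proof.
move=> f0 fg; rewrite !ge0_integralTE//; last first.
  by move=> x; exact: le_trans (fg x).
apply: ge_ereal_sup => _ [h hf <-]; apply: ereal_sup_ubound; exists h => //= x.
exact: le_trans (fg x).
Qed.

Section radon_nikodym.
Context (R : realType) (k : scalar_kind) d (T : measurableType d)
  (lam : {finite_measure set T -> \bar R}).
Local Notation K := (scalars R k).
Context (Y : completeNormedModType K).
Implicit Types (s t : T -> Y).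

Lemma simple_fun_seq s : simple_fun s ->
  exists l : seq Y, uniq l /\ range s = [set` l].
Proof.
move=> [/finite_seqP[l sl] _]; exists (undup l); rewrite undup_uniq sl; split => //.
by apply/seteqP; split => y /=; rewrite mem_undup.
Qed.

(** The pair [(s, t)] takes finitely many values, each on a measurable set, so the preimage is a
    finite union and no sigma-algebra on [Y] is involved. *)
Lemma measurable_simple2 (h : Y -> Y -> R) s t : simple_fun s -> simple_fun t ->
  measurable_fun setT (fun x => h (s x) (t x)).
Proof.
move=> [fs ms] [ft mt] _ B mB; rewrite setTI.
rewrite (_ : _ @^-1` B = \bigcup_(y in range s) \bigcup_(z in range t)
    (s @^-1` [set y] `&` t @^-1` [set z] `&` [set _ | B (h y z)])).
  apply: fin_bigcup_measurable => // y _; apply: fin_bigcup_measurable => // z _.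
  apply: measurableI; first exact: measurableI.
  have [Bh|nBh] := pselect (B (h y z)).
    by rewrite (_ : [set _ | _] = setT)//; apply/seteqP; split.
  by rewrite (_ : [set _ | _] = set0)//; apply/seteqP; split.
apply/seteqP; split => [x Bx|x [y _ [z _ [[/= -> ->]]]]//].
by exists (s x); [exists x|exists (t x); [exists x|]].
Qed.

Lemma simple_fun_cst (y : Y) : simple_fun (fun _ : T => y).
Proof.
split; first by apply: sub_finite_set (finite_set1 y) => _ [x _ <-].
move=> z; have [->|yz] := eqVneq y z.
  by rewrite (_ : _ @^-1` _ = setT)//; apply/seteqP; split.
rewrite (_ : _ @^-1` _ = set0)//; apply/seteqP; split => // x /= e.
by move: yz; rewrite e eqxx.
Qed.

Lemma simple_fun_if (N : set T) s t : measurable N -> simple_fun s -> simple_fun t ->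
  simple_fun (fun x => if x \in N then s x else t x).
Proof.
move=> mN [fs ms] [ft mt]; split.
  apply: (@sub_finite_set _ _ (range s `|` range t)); last by rewrite finite_setU.
  by move=> _ [x _ <-]; case: ifP => _; [left|right]; exists x.
move=> y; rewrite (_ : _ @^-1` _ = (N `&` s @^-1` [set y]) `|` (~` N `&` t @^-1` [set y])).
  by apply: measurableU; apply: measurableI => //; exact: measurableC.
apply/seteqP; split => [x /=|x [] [Nx <-] /=].
- by case: ifPn => [|/negP]; rewrite inE; [left|right].
- by rewrite mem_set.
- by rewrite memNset.
Qed.

Lemma integral_simple (E : set T) s (l : seq Y) (h : Y -> R) : measurable E ->
  simple_fun s -> uniq l -> range s = [set` l] -> (forall y, 0 <= h y) ->
  (\int[lam]_(x in E) (h (s x))%:E)%E =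
    (\sum_(y <- l) h y * fine (lam (E `&` s @^-1` [set y])))%:E.
Proof.
move=> mE ss ul sl h0; pose F y := E `&` s @^-1` [set y].
have mF y : measurable (F y) by apply: measurableI => //; exact: (proj2 ss).
have EF : E = \big[setU/set0]_(y <- l) F y.
  rewrite -bigcup_seq; apply/seteqP; split => [x Ex|x [y _ []//]].
  by exists (s x) => //; rewrite -sl; exists x.
rewrite {1}EF ge0_integral_bigsetU//.
- rewrite -sumEFin; apply: eq_bigr => y _.
  rewrite (eq_integral (cst (h y)%:E)); last by move=> x; rewrite inE => -[_ /= ->].
  rewrite integral_cst// EFinM fineK//; exact: (fin_num_measure lam _ (mF y)).
- by move=> y z _ _ [x [[_ <-] [_ <-]]].
- apply/measurable_EFinP; apply: measurable_funTS.
  exact: (measurable_simple2 (fun y _ => h y) ss (simple_fun_cst 0)).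
- by move=> x _; rewrite lee_fin.
Qed.

Lemma simple_integral_dist (E : set T) s (v : Y) : measurable E -> simple_fun s ->
  ((rnorm (simple_integral lam E s - sofR k (fine (lam E)) *: v))%:E <=
    \int[lam]_(x in E) (rnorm (s x - v))%:E)%E.
Proof.
move=> mE ss; have [l [ul sl]] := simple_fun_seq ss.
have lamE : fine (lam E) = \sum_(y <- l) fine (lam (E `&` s @^-1` [set y])).
  have := @integral_simple E s l (cst 1) mE ss ul sl (fun _ => ler01).
  rewrite /= (eq_integral (cst 1%E))// integral_cst// mul1e => ->.
  by apply: eq_bigr => y _; rewrite mul1r.
rewrite (@integral_simple E s l (fun y => rnorm (y - v)))//; last first.
  by move=> y; exact: rnorm_ge0.
rewrite lee_fin /simple_integral sl -fsbig_seq// lamE.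
rewrite (big_morph _ (@sofRD R k) (sofR0 R k)) scaler_suml -sumrB.
rewrite (le_trans (rnorm_sum _ _ _))//; apply: ler_sum => y _.
by rewrite -scalerBr rnormZR ger0_norm ?fine_ge0// mulrC.
Qed.

Lemma rnorm_dist_cvg (u : nat -> Y) y z :
  u n @[n --> \oo] --> y -> rnorm (z - u n) @[n --> \oo] --> rnorm (z - y).
Proof.
move=> /rnorm_cvgP uy; apply/cvgrPdist_lt => e e0.
move/cvgrPdist_lt : uy => /(_ _ e0); apply: filterS => n.
rewrite sub0r normrN ger0_norm ?rnorm_ge0// => h.
apply: le_lt_trans (rnorm_dist _ _) _.
by rewrite opprB addrC subrKA.
Qed.

(** Up to a null set [g] takes its values in the closure of the countable set of values of the
    approximating simple functions. Sorting the points by the first such value within [dl] of [g]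
    gives the pieces, and there the integral over [E] differs from [lam E] times that value by at
    most [dl * lam E]. *)
Lemma bochner_integral_partition (g : T -> Y) (G : set T -> Y) (dl : R) : 0 < dl ->
  strongly_measurable lam g ->
  (forall E, measurable E -> is_bochner_integral lam E g (G E)) ->
  exists (C : nat -> set T) (v : nat -> Y),
    [/\ forall i, measurable (C i), trivIset setT C, \bigcup_i C i = setT &
      forall i E, measurable E -> E `<=` C i ->
        rnorm (G E - sofR k (fine (lam E)) *: v i) <= dl * fine (lam E)].
Proof.
move=> dl0 [t0 [st0 [N [mN N0 cN]]]] hG.
(* After the change on the null set [N] the simple functions converge everywhere, which makes the
   distances to [g'] measurable. *)
pose g' x := if x \in N then 0 else g x.
pose t m x := if x \in N then 0 else t0 m x.
have st m : simple_fun (t m).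
  by apply: simple_fun_if => //; exact: simple_fun_cst.
have tg x : t m x @[m --> \oo] --> g' x.
  rewrite /t /g'; case: ifPn => [_|]; first exact: cvg_cst.
  move/negP => xN; apply: contrapT => h; apply: xN; rewrite inE; exact: cN.
have mdist s : simple_fun s -> measurable_fun setT (fun x => rnorm (s x - g' x)).
  move=> ss; apply: (measurable_fun_cvg (h := fun m x => rnorm (s x - t m x))).
    by move=> m; exact: (measurable_simple2 (fun y z => rnorm (y - z)) ss (st m)).
  by move=> x _; apply: rnorm_dist_cvg; exact: tg.
have [l hl] : {l : nat -> seq Y & forall m, range (t m) = [set` l m]}.
  apply: (@choice _ _ (fun m l => range (t m) = [set` l])) => m.
  by have [l [_ ?]] := simple_fun_seq (st m); exists l.
pose v i : Y := if unpickle i is Some (m, j) then nth 0 (l m : seq Y) (j : nat) else 0.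
pose C0 i := [set x | rnorm (v i - g' x) < dl].
have mC0 i : measurable (C0 i).
  rewrite -[C0 i]setTI.
  have -> : C0 i = (fun x => rnorm (v i - g' x)) @^-1` `]-oo, dl[.
    by apply/seteqP; split => x /=; rewrite in_itv.
  by apply: (mdist _ (simple_fun_cst (v i))).
have C0T : \bigcup_i C0 i = setT.
  apply/seteqP; split => // x _.
  have /rnorm_cvgP/cvgrPdist_lt/(_ _ dl0)[m _ /(_ m (leqnn m))] := tg x.
  rewrite sub0r normrN ger0_norm ?rnorm_ge0// => tm.
  have /(nthP 0)[j _ tj] : t m x \in l m.
    by have : [set` l m] (t m x) by rewrite -hl; exists x.
  by exists (pickle (m, j)) => //; rewrite /C0 /= /v pickleK tj.
exists (seqDU C0), v; split.
- exact: seqDU_measurable.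
- exact: trivIset_seqDU.
- by rewrite -seqDU_bigcup_eq.
move=> i E mE EC; have [_ [s [[ss s0] sG]]] := hG E mE.
have lamE : (0 <= fine (lam E)) by exact: fine_ge0.
have s_le n : ((rnorm (simple_integral lam E (s n) - sofR k (fine (lam E)) *: v i))%:E <=
    \int[lam]_x (rnorm (s n x - g x))%:E + (dl * fine (lam E))%:E)%E.
  apply: le_trans (simple_integral_dist (v i) mE (ss n)) _.
  have mfd := measurable_funTS (mdist _ (ss n)).
  apply: (@le_trans _ _ (\int[lam]_(x in E) ((rnorm (s n x - g' x))%:E + dl%:E))%E).
    apply: ge0_le_integral => //.
    - by move=> x _; rewrite lee_fin rnorm_ge0.
    - apply/measurable_EFinP; apply: measurable_funTS.
      exact: (measurable_simple2 (fun y _ => rnorm (y - v i)) (ss n) (simple_fun_cst 0)).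
    - by apply: emeasurable_funD => //; apply/measurable_EFinP; exact: mfd.
    - move=> x /EC[C0x _]; rewrite -EFinD lee_fin.
      rewrite (le_trans (rnorm_trans (g' x) _ _))// lerD// rdistC; exact: ltW.
  rewrite ge0_integralD//; last 3 first.
  - by move=> x _; rewrite lee_fin rnorm_ge0.
  - by apply/measurable_EFinP; exact: mfd.
  - by move=> x _; rewrite lee_fin ltW.
  rewrite integral_cst// EFinM fineK ?fin_num_measure// leeD2r//.
  apply: (@le_trans _ _ (\int[lam]_x (rnorm (s n x - g' x))%:E)%E).
    apply: ge0_subset_integral => //.
    - by apply/measurable_EFinP; exact: mdist.
    - by move=> x _; rewrite lee_fin rnorm_ge0.
  (* The distance to [g] itself need not be measurable. The distance to [g'] cut off on [N] is
     measurable and lies below it at every point, so [integral_monotone] concludes. *)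
  rewrite (ae_eq_integral (fun x => ((rnorm (s n x - g' x)) * \1_(~` N) x)%:E))//.
  - apply: integral_monotone => x.
      by rewrite lee_fin mulr_ge0 ?rnorm_ge0// indicE ler0n.
    rewrite lee_fin /g' indicE in_setC; case: ifP => _ /=.
      by rewrite mulr0 rnorm_ge0.
    by rewrite mulr1.
  - by apply/measurable_EFinP; exact: mdist.
  - apply/measurable_EFinP; apply: measurable_funM; first exact: mdist.
    by apply: measurable_indic; exact: measurableC.
  - exists N; split => // x /= h; apply: contrapT => xN; apply: h => _.
    by rewrite indicE mem_set// mulr1.
apply/ler_addgt0Pr => e e0; have e20 : 0 < e / 2 by rewrite divr_gt0.
have /rnorm_cvgP/cvgrPdist_lt/(_ _ e20) := sG.
have /fine_cvgP[] := s0; move=> /[swap] /cvgrPdist_lt/(_ _ e20).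
move=> h1 h2 h3; have [n _ /(_ n (leqnn n))] := filterI h1 (filterI h2 h3).
rewrite /= !sub0r !normrN => -[i_lt [i_fin d_lt]].
move: (s_le n); rewrite -(fineK i_fin) -EFinD lee_fin => s_le'.
apply: (le_trans (rnorm_trans (simple_integral lam E (s n)) _ _)).
rewrite ger0_norm ?rnorm_ge0// rdistC in d_lt.
apply: le_trans (lerD (ltW d_lt) s_le') _.
rewrite addrA [leRHS]addrC lerD2r [leRHS](splitr e) lerD2l ltW//.
exact: le_lt_trans (ler_norm _) i_lt.
Qed.

End radon_nikodym.

(** * The vector measure of an operator and the phase of a function *)

Section second_part.
Context (R : realType) (k : scalar_kind) d (T : measurableType d)
  (mu : {measure set T -> \bar R}).
Local Notation K := (scalars R k).
Local Notation X := (L1 k mu).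
Context (Y : completeNormedModType K).

Lemma fine_L1measure (f : X) E : measurable E ->
  fine (L1measure f E) = rnorm (restr E f).
Proof. by move=> mE; rewrite -rnorm_restr. Qed.

(* [E |-> V (restr E f)] is a vector measure dominated by [|f| mu]; the
   approximating vector on a piece [C i] is replaced by the average [y i] of that
   vector measure over [C i]. *)
Lemma RNP_partition (V : {linear X -> Y}) (f : X) (dl : R) :
  Radon_Nikodym_property Y -> (forall h, rnorm (V h) <= rnorm h) -> 0 < dl ->
  exists (C : nat -> set T) (y : nat -> Y),
    [/\ forall i, measurable (C i), trivIset setT C, \bigcup_i C i = setT &
        forall i, rnorm (y i) <= 1] /\
    [/\ forall i, sofR k (rnorm (restr (C i) f)) *: y i = V (restr (C i) f) &
        forall i E, measurable E -> E `<=` C i ->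
          rnorm (sofR k (rnorm (restr E f)) *: y i - V (restr E f)) <=
            dl * rnorm (restr E f)].
Proof.
move=> rnp V1 dl0; pose G E := V (restr E f).
have Vb : bounded_operators X Y V.
  by apply: (@bounded_continuous _ _ _ _ _ 1) => h; rewrite mul1r.
have vG : vector_measure G.
  move=> F mF tF; have := bounded_cvg Vb (@restr_cvg _ _ _ _ _ F f mF tF).
  apply: cvg_trans; apply: near_eq_cvg; apply: nearW => n.
  by rewrite /series /= big_mkord linear_sum.
have bG : bounded_variation_measure G.
  apply: (@le_lt_trans _ _ (L1measure f setT)); last first.
    by rewrite -rnorm_restr// ltry.
  apply: ge_ereal_sup => _ [n [F [mF tF _ ->]]].
  have mU : measurable (\big[setU/set0]_(i < n) F i) by exact: bigsetU_measurable.
  apply: (@le_trans _ _ (L1measure f (\big[setU/set0]_(i < n) F i))); last first.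
    by apply: le_measure; rewrite ?inE.
  rewrite (measure_bigsetU_ord_cond (L1measure f) (P := xpredT)) //; last first.
    by apply/trivIsetP => i j _ _ ij; move/trivIsetP : tF; apply.
  apply: lee_sum => i _.
  apply: (@le_trans _ _ (rnorm (restr (F i) f))%:E); last by rewrite (rnorm_restr f (mF i)).
  by rewrite lee_fin; exact: V1.
have aG : abs_continuous (L1measure f) G.
  move=> e e0; exists e; split => // E mE.
  move=> Ee; have : ((rnorm (restr E f))%:E < e%:E)%E by rewrite (rnorm_restr f mE).
  by rewrite lte_fin; apply: le_lt_trans; exact: V1.
have [g [[sg _] hg]] := rnp d T (L1measure f) G vG bG aG.
(* One half of [dl] is for the vector [v i] of the partition, the other for replacing it by the
   average [y i]. *)
have dl20 : 0 < dl / 2 by rewrite divr_gt0.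
have [C [v [mC tC UC hC]]] := bochner_integral_partition dl20 sg hg.
pose a i := rnorm (restr (C i) f).
have a0 i : 0 <= a i by exact: rnorm_ge0.
pose y i := sofR k (a i)^-1 *: V (restr (C i) f).
have ay i : sofR k (a i) *: y i = V (restr (C i) f).
  rewrite scalerA -sofRM; have [ai0|ai0] := eqVneq (a i) 0.
    by rewrite (rnorm_eq0 ai0) linear0 scaler0.
  by rewrite mulfV// sofR1 scale1r.
exists C, y; split; split => //.
  move=> i; rewrite rnormZR ger0_norm ?invr_ge0//.
  have [ai0|ai0] := eqVneq (a i) 0; first by rewrite ai0 invr0 mul0r ler01.
  by rewrite mulrC ler_pdivrMr ?mul1r ?V1// lt_neqAle eq_sym ai0 a0.
move=> i E mE EC; have aE := rnorm_restr_le f mE (mC i) EC.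
have [ai0|ai0] := eqVneq (a i) 0.
  have E0 : rnorm (restr E f) = 0.
    by apply/eqP; rewrite eq_le rnorm_ge0 andbT -ai0.
  by rewrite E0 (rnorm_eq0 E0) linear0 sofR0 scale0r subr0 rnorm0 mulr0.
have aip : 0 < a i by rewrite lt_neqAle eq_sym ai0 a0.
have hE := hC i E mE EC; have hCi := hC i (C i) (mC i) (@subset_refl _ (C i)).
rewrite fine_L1measure// in hE; rewrite fine_L1measure// -/(a i) in hCi.
(* This is the estimate on the whole piece [C i], divided by its mass [a i]. *)
have yv : rnorm (y i - v i) <= dl / 2.
  rewrite -(ler_pM2l aip) -[X in X * rnorm _]ger0_norm// -rnormZR scalerBr ay.
  by rewrite mulrC.
rewrite rdistC; apply: (le_trans (rnorm_trans (sofR k (rnorm (restr E f)) *: v i) _ _)).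
rewrite [dl]splitr mulrDl lerD// -scalerBr rnormZR ger0_norm ?rnorm_ge0// rdistC.
by rewrite mulrC ler_wpM2r ?rnorm_ge0.
Qed.

Lemma restr_L1support (f : X) : restr (L1support f) f = f.
Proof.
rewrite -{3}[f]L1reprK /Lmul; apply: L1class_eq => x.
change (indic_multiplier R k (L1support f) x * L1repr f x = L1repr f x).
rewrite indic_multiplierE; last exact: measurable_L1support.
case: ifPn => [_|]; first by rewrite mul1r.
by rewrite notin_setE /L1support /= => /negP/negPn/eqP ->; rewrite mulr0.
Qed.

Lemma phase_measurable (f : X) :
  scalar_measurable (fun x => `|L1repr f x : K| * (L1repr f x)^-1).
Proof.
have mf := L1fun_meas (L1repr f).
apply: scalar_measurableM; last exact: scalar_measurableV.
have := scalar_measurable_sofR k (scalar_measurable_norm mf).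
by under eq_fun do rewrite sofR_norm.
Qed.

Lemma phase_le1 (f : X) x : sre `| `|L1repr f x : K| * (L1repr f x)^-1 | <= 1.
Proof.
rewrite normrM normr_id normfV; have [->|h] := eqVneq (L1repr f x : K) 0.
  by rewrite normr0 mul0r sre0 ler01.
by rewrite mulfV ?normr_eq0// -sofR1 sre_sofR.
Qed.

(** Multiplication by [|f| / f] turns [f] into [|f|]. Off the support the value is 0, by the
    convention for the inverse of 0. *)
Definition phase (f : X) : multiplier R k T :=
  Multiplier (phase_measurable f) (phase_le1 f).

Lemma L1int_phase (f : X) E : measurable E ->
  L1int (Lmul (phase f) (restr E f)) = sofR k (rnorm (restr E f)).
Proof.
move=> mE.
have wE : Lmul (phase f) (restr E f) =
    L1class (mul_L1fun (phase f) (mul_L1fun (indic_multiplier R k E) (L1repr f))).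
  by rewrite [restr E f]/Lmul Lmul_class.
pose p x := sre `|mul_L1fun (indic_multiplier R k E) (L1repr f) x : K|.
have wp x : mul_L1fun (phase f) (mul_L1fun (indic_multiplier R k E) (L1repr f)) x =
    sofR k (p x).
  rewrite /p sofR_norm.
  change (`|L1repr f x : K| * (L1repr f x)^-1 *
    (indic_multiplier R k E x * L1repr f x) = `|indic_multiplier R k E x * L1repr f x|).
  rewrite indic_multiplierE//; case: ifP => _; last by rewrite mul0r mulr0 normr0.
  rewrite !mul1r; have [->|h] := eqVneq (L1repr f x : K) 0.
    by rewrite mulr0 normr0.
  by rewrite divfK.
rewrite wE (L1int_sofR (p := p))//; last by move=> x; exact: sre_norm_ge0.
congr sofR; rewrite [in RHS]/Lmul !rnorm_L1class; apply: eq_Rintegral => x _.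
by rewrite wp norm_sofR sre_sofR ger0_norm ?sre_norm_ge0.
Qed.

(** The hypothesis compares the two operators on restrictions of [f] only. Their difference, cut off
    outside [C], is one bounded linear map, and [bound_on_support] carries the estimate over to
    every [h]. *)
Lemma phase_step_bound (V : {linear X -> Y}) (f : X) (C : set T) (y : Y) (dl : R) :
  (forall h, rnorm (V h) <= rnorm h) -> rnorm y <= 1 -> 0 <= dl -> measurable C ->
  (forall E, measurable E -> E `<=` C ->
    rnorm (sofR k (rnorm (restr E f)) *: y - V (restr E f)) <= dl * rnorm (restr E f)) ->
  forall h, rnorm (L1int (Lmul (phase f) (restr (C `&` L1support f) h)) *: y -
    V (restr (C `&` L1support f) h)) <= dl * rnorm (restr (C `&` L1support f) h).
Proof.
move=> V1 y1 dl0 mC hC h; have mU := measurable_L1support f.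
pose P : {linear X -> Y} :=
  step_op (phase f) (fun=> C) (fun=> y) xpredT 1 \- (V \o Lmul (indic_multiplier R k C)).
have PE u : P u = L1int (Lmul (phase f) (restr C u)) *: y - V (restr C u).
  by rewrite /P /= /step_op big_ord_recl big_ord0 addr0.
have Pb : bounded_operators X Y P.
  apply: (@bounded_continuous _ _ _ _ _ 2) => u; rewrite PE.
  apply: (le_trans (rnormD _ _)); rewrite rnormN mulrDl mul1r lerD//.
    rewrite rnormZ; apply: (@le_trans _ _ (sre `|L1int (Lmul (phase f) (restr C u))|)).
      by rewrite ler_piMr// sre_norm_ge0.
    exact: le_trans (norm_L1int_Lmul _ _) (rnorm_Lmul _ _).
  exact: le_trans (V1 _) (rnorm_Lmul _ _).
have Pf E : measurable E -> rnorm (P (restr E f)) <= dl * rnorm (restr E f).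
  move=> mE; have mCE := measurableI _ _ mC mE.
  rewrite PE restrI// L1int_phase//.
  apply: (le_trans (hC _ mCE (@subIsetl _ _ _))).
  by rewrite ler_wpM2l//; apply: rnorm_restr_le => //; exact: subIsetr.
have mCU := measurableI _ _ mC mU.
(* Applying the bound to a function already restricted to the piece keeps that restriction in the
   right-hand side, so that the bounds can later be summed over the pieces. *)
have := bound_on_support Pb dl0 Pf (restr (C `&` L1support f) h).
rewrite restrI// (setIidr (@subIsetr _ _ _)) PE restrI//.
by rewrite (setIidr (@subIsetl _ _ _)).
Qed.

Lemma dual_sphere_scale (f : {linear Y -> K^o}) (c : K) : sre `|c| = 1 ->
  dual_sphere Y f -> dual_sphere Y (scale_form c f).
Proof.
move=> c1 fn; have cf v : rnorm (scale_form c f v) = rnorm (f v).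
  by rewrite /rnorm /scale_form normrM sre_normM c1 mul1r.
split.
  apply: (@bounded_continuous _ _ _ _ _ 1) => v; rewrite mul1r cf.
  exact: dual_sphere_le.
by rewrite -fn.2 /opnorm; congr sup; apply: eq_imagel => v _; rewrite cf.
Qed.

End second_part.

(** * From the AHSp to the BPBZp *)

Section second_part_main.
Context (R : realType) (k : scalar_kind) d (T : measurableType d)
  (mu : {measure set T -> \bar R}).
Local Notation K := (scalars R k).
Local Notation X := (L1 k mu).
Lemma YstarAHSp_BPBZp (Y : completeNormedModType K) :
  YstarAHSp Y -> Radon_Nikodym_property Y -> BPBZp X Y.
Proof.
move=> ahsp rnp eps eps0.
have [e4 e44] : eps / 4 < eps /\ eps / 4 + eps / 4 < eps by split; lra.
(* The distance from [S] to [V] is at most [eps / 4] for the partition plus [ep] for moving [y j] to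
   [z j]; the bound [1 / 2] keeps the retained mass [s] positive. *)
pose ep := Num.min (eps / 4) (1 / 2).
have ep0 : 0 < ep by rewrite lt_min !divr_gt0.
have ep_eps : ep <= eps / 4 by rewrite ge_min lexx.
have ep_half : ep <= 1 / 2 by rewrite ge_min lexx orbT.
have [eta1 [eta10 hA]] := ahsp _ ep0.
(* With [eta <= 1] the scalar [ystar0 (V f)] is nonzero and can be rotated onto its modulus. *)
pose eta := Num.min eta1 1; exists eta.
have eta0 : 0 < eta by rewrite lt_min eta10 ltr01.
have etale : eta <= eta1 by rewrite ge_min lexx.
have etale1 : eta <= 1 by rewrite ge_min lexx orbT.
split => // V ystar0 f Vb Vn ystar0n f1 hc.
have [ystar0b _] := ystar0n.
have V1 h : rnorm (V h) <= rnorm h by have := opnormP Vb h; rewrite Vn mul1r.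
pose c : K := ystar0 (V f).
have cpos : 0 < sre `|c|.
  by apply: le_lt_trans hc; rewrite subr_ge0.
have c0 : c != 0 by apply/eqP => c0; move: cpos; rewrite c0 normr0 sre0 ltxx.
pose th : K := `|c| / c.
have th1 : sre `|th| = 1.
  by rewrite normrM normr_id normfV mulfV ?normr_eq0// -sofR1 sre_sofR.
have th0 : th != 0.
  by apply/eqP => h; move: th1; rewrite h normr0 sre0 => /esym/eqP; rewrite oner_eq0.
have thV1 : sre `|th^-1| = 1.
  by rewrite normfV -[`|th|]sofR_norm th1 sofR1 invr1 -sofR1 sre_sofR.
pose ystar : {linear Y -> K^o} := scale_form th ystar0.
have ystarn : dual_sphere Y ystar by exact: dual_sphere_scale.
have [ystarb _] := ystarn.
have dl0 : 0 < eps / 4 by rewrite divr_gt0.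
have [C [y [[mC tC UC y1] [ay hCy]]]] := RNP_partition f rnp V1 dl0.
pose a j := rnorm (restr (C j) f).
have a0 j : 0 <= a j by exact: rnorm_ge0.
have acvg : \sum_(j < n) a j @[n --> \oo] --> (1 : R).
  by have := @rnorm_restr_cvg _ _ _ _ _ C f mC tC; rewrite UC restrT f1.
have suma : (\sum_(0 <= j <oo) `|a j|%:E)%E = 1%E.
  have aE n : (\sum_(0 <= j < n) `|a j|%:E = (\sum_(j < n) a j)%:E)%E.
    by rewrite -sumEFin big_mkord; apply: eq_bigr => j _; rewrite ger0_norm.
  apply/cvg_lim => //; apply/fine_cvgP; split.
    by apply: nearW => n; rewrite aE.
  by apply: cvg_trans acvg; apply: near_eq_cvg; apply: nearW => n /=; rewrite aE.
(* The [y j] being averages, the series gives [V f] without error, and the AHSp can be used with its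
   own [eta1]. *)
have limV : limn (series (fun j => sofR k (a j) *: y j)) = V f.
  apply/cvg_lim; first exact: norm_hausdorff.
  have := bounded_cvg Vb (@restr_cvg _ _ _ _ _ C f mC tC); rewrite UC restrT.
  apply: cvg_trans; apply: near_eq_cvg; apply: nearW => n.
  by rewrite /series /= big_mkord linear_sum; apply: eq_bigr => j _; rewrite ay.
have reV : sre (ystar (limn (series (fun j => sofR k (a j) *: y j)))) > 1 - eta1.
  rewrite limV /ystar /= /scale_form -/c /th divfK// -sofR_norm sre_sofR.
  by apply: le_lt_trans hc; rewrite lerB.
have [A [z [zs [[z1 zsn] [sumA zy zsz zsy]]]]] := hA y ystar a y1 ystarn a0 suma reV.
have [zsb _] := zsn; have zs_le := dual_sphere_le zsn.
have [N sumN] : exists N, 1 - ep < \sum_(j < N | (j : nat) \in A) a j.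
  apply: (lt_nneseries (P := fun j => j \in A)) => //.
  rewrite (@nneseries_esum _ (fun j => (a j)%:E) (fun j => j \in A)); last first.
    by move=> j _; rewrite lee_fin.
  by rewrite (_ : [set j | j \in A] = A)//; apply/seteqP; split => j /=; rewrite inE.
have mU := measurable_L1support f.
pose F j := C j `&` L1support f.
have mF j : measurable (F j) by exact: measurableI.
have tF : trivIset setT F.
  apply/trivIsetP => i j _ _ ij; rewrite /F setIACA.
  by have /trivIsetP -> := tC; rewrite ?set0I.
have Ff j : restr (F j) f = restr (C j) f by rewrite -restrI// restr_L1support.
pose P : pred nat := fun j => j \in A.
pose B := \big[setU/set0]_(j < N | P j) F j.
have mB : measurable B by exact: bigsetU_measurable.
have FB (j : 'I_N) : P j -> F j `<=` B.
  by move=> Pj; rewrite /B (bigD1 j)//=; exact: subsetUl.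
pose s := \sum_(j < N | P j) a j.
rewrite -[X in _ < X]/s in sumN.
have sE : rnorm (restr B f) = s.
  by rewrite rnorm_restr_bigsetU//; apply: eq_bigr => j _; rewrite Ff.
have s1 : s <= 1 by rewrite -sE -f1; exact: rnorm_Lmul.
have s0 : 0 < s.
  apply: le_lt_trans sumN; rewrite subr_ge0 (le_trans ep_half)//.
  by rewrite ler_pdivrMr// mul1r ler1n.
have z_le (j : 'I_N) : P j -> rnorm (z j) <= 1.
  by rewrite /P inE => /z1 zj; rewrite zj.
pose Q : {linear X -> Y} := step_op (phase f) F z P N.
(* The norm of [h] is the sum of its norms on [B] and on the complement, and each summand of [S] is
   a contraction on its part, so [S] needs no renormalization. *)
pose S : {linear X -> Y} := (V \o Lmul (indic_multiplier R k (~` B))) \+ Q.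
have SE h : S h = V (restr (~` B) h) + Q h by [].
have S_le h : rnorm (S h) <= rnorm h.
  rewrite SE -(rnorm_restrC h mB) addrC; apply: (le_trans (rnormD _ _)).
  by apply: lerD; [exact: rnorm_step_op|exact: V1].
have Sb : bounded_operators X Y S.
  by apply: (@bounded_continuous _ _ _ _ _ 1) => h; rewrite mul1r.
have SV h : rnorm (S h - V h) <= (eps / 4 + eps / 4) * rnorm h.
  have -> : S h - V h = Q h - V (restr B h).
    rewrite SE restrC// linearB /=;
    by rewrite addrAC [X in X - _ + _]addrC addrK addrC.
  rewrite /B restr_bigsetU// linear_sum /= /step_op -sumrB.
  apply: (le_trans (rnorm_sum _ _ _)).
  apply: (@le_trans _ _ (\sum_(j < N | P j) (eps / 4 + eps / 4) * rnorm (restr (F j) h))).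
    apply: ler_sum => j Pj; set q := L1int _.
    have -> : q *: z j - V (restr (F j) h) =
        q *: (z j - y j) + (q *: y j - V (restr (F j) h)).
      by rewrite scalerBr subrKA.
    apply: (le_trans (rnormD _ _)); rewrite mulrDl; apply: lerD.
      rewrite rnormZ mulrC ler_pM ?rnorm_ge0 ?sre_norm_ge0//.
        by apply: le_trans ep_eps; apply: ltW; apply: zy; move: Pj; rewrite /P inE.
      exact: norm_L1int_Lmul.
    exact: (phase_step_bound V1 (y1 j) (ltW dl0) (mC j) (hCy j)).
  rewrite -mulr_sumr -rnorm_restr_bigsetU// ler_wpM2l ?rnorm_Lmul//.
  by rewrite addr_ge0// ltW.
(* Restricting [f] to [B] loses the mass [1 - s < ep], and normalizing costs the same amount again,
   so [x1] is within [2 * ep] of [f]. *)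
pose x1 := sofR k s^-1 *: restr B f.
have x1n : rnorm x1 = 1.
  by rewrite rnormZR ger0_norm ?invr_ge0 ?(ltW s0)// sE mulVf// gt_eqF.
have SB : S (restr B f) = Q (restr B f).
  rewrite SE restrI ?setICl ?restr0 ?linear0 ?add0r//; exact: measurableC.
have zsS : zs (S x1) = 1.
  rewrite [S x1](linearZ_LR S) [zs _](linearZ_LR zs) [S _]SB /Q /= /step_op linear_sum /=.
  rewrite (eq_bigr (fun j : 'I_N => sofR k (a j))); last first.
    move=> j Pj; rewrite linearZ_LR /= restrI// (setIidl (FB j Pj)) L1int_phase// Ff.
    by rewrite zsz ?[_ *: _]mulr1//; move: Pj; rewrite /P inE.
  rewrite -(big_morph _ (@sofRD R k) (sofR0 R k)) -/s -[_ *: _]sofRM.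
  by rewrite mulVf ?sofR1// gt_eqF.
have Sx1 : rnorm (S x1) = 1.
  have h1 := S_le x1; rewrite x1n in h1; have h2 := zs_le (S x1).
  by apply/eqP; rewrite eq_le h1; move: h2; rewrite zsS normr1 -sofR1 sre_sofR.
pose ystar1 : {linear Y -> K^o} := scale_form th^-1 zs.
have ystar1n : dual_sphere Y ystar1 by exact: dual_sphere_scale.
exists ystar1, x1, S; split; first by split.
split.
- exact: opnorm_eq1 S_le x1n Sx1.
- by rewrite /ystar1 /= /scale_form zsS mulr1.
- have -> : x1 - f = sofR k (s^-1 - 1) *: restr B f - restr (~` B) f.
    by rewrite restrC// sofRB sofR1 scalerBl scale1r opprB addrA subrK.
  apply: (le_lt_trans (rnormD _ _)); rewrite rnormN rnormZR.
  rewrite ger0_norm ?subr_ge0 ?invf_ge1// sE mulrBl mulVf ?gt_eqF// mul1r.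
  have hh := rnorm_restrC f mB; rewrite sE f1 in hh.
  have -> : rnorm (restr (~` B) f) = 1 - s by rewrite -hh addrAC subrr add0r.
  by move: sumN ep_eps eps0; clear; clearbody s ep; lra.
- apply: (@le_lt_trans _ _ ep); last first.
    exact: le_lt_trans ep_eps e4.
  apply: opnorm_le; first exact: ltW.
  move=> v; have -> : ystar1 v - ystar0 v = th^-1 * (zs v - ystar v) :> K^o.
    by rewrite mulrBr /ystar /= /scale_form mulKf.
  rewrite /rnorm normrM sre_normM thV1 mul1r.
  apply: (le_trans (opnorm_distP zsb ystarb v)).
  by rewrite ler_wpM2r ?rnorm_ge0// ltW.
- apply: (@le_lt_trans _ _ (eps / 4 + eps / 4)) => //.
  by apply: opnorm_le => //; rewrite addr_ge0// ltW.
Qed.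

End second_part_main.

Unset Implicit Arguments.

Theorem theorem3p14 (R : realType) (k : scalar_kind) (d : measure_display)
    (T : measurableType d) (mu : {measure set T -> \bar R})
    (Y : completeNormedModType (scalars R k)) :
  infinite_dimensional (L1 k mu) ->
  (BPBZp (L1 k mu) Y -> YstarAHSp Y) /\
  (YstarAHSp Y -> Radon_Nikodym_property Y -> BPBZp (L1 k mu) Y).
Proof.
by move=> infX; split; [exact: BPBZp_YstarAHSp|exact: YstarAHSp_BPBZp].
Qed.
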